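(* Let $n\ge4$ and $W=W(D_n)$. Then there is a unique longest bad element of $W$, namely $w_n$. Every other bad element in $W$ is of the form $w_k\cdot u$ where $k<n$ and $u$ is a product of mutually commuting generators not in $\operatorname{supp}(w_k)$. Furthermore, if $n$ is odd then $w_n=w_{n-1}$.
   Context: $W(D_n)$ is the Coxeter group with generators $s_1,\dots,s_n$, where $s_1s_3$, $s_2s_3$, $s_is_{i+1}$ ($3\le i\le n-1$) have order 3 and all other pairs of distinct generators commute, realized as signed permutations of $\{\pm1,\dots,\pm n\}$ with an even number of sign changes via $s_1\mapsto(1,-2)(-1,2)$, $s_i\mapsto(i-1,i)(-(i-1),-i)$ ($i\ge2$), products being compositions of functions, and one-line notation $(w(1),\dots,w(n))$. An element is bad if it is not a product of mutually commuting generators and no reduced expression of it begins or ends with two noncommuting generators. $\operatorname{supp}(w)$ is the set of generators appearing in a reduced expression of $w$. For even $m$ with $0\le m\le n$, $w_m$ is defined by $w_m(1)=(-1)^{m/2}$ (if $m\ge1$), $w_m(i)=i$ for odd $1<i\le m$, $w_m(i)=-(m+2-i)$ for even $i\le m$, $w_m(i)=i$ for $i>m$; for odd $m$, $w_m=w_{m-1}$. *)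

(* Defs.v *)
From mathcomp Require Import all_boot all_fingroup ssralg ssrint.
Set Implicit Arguments.
Unset Strict Implicit.
Unset Printing Implicit Defensive.
Import GroupScope.

(* The set {1, -1, ..., n, -n}: the pair (b, i) stands for (-1)^b * (i + 1),  *)
(* since the elements of 'I_n are numbered from 0 instead of 1.               *)
Notation point n := (bool * 'I_n)%type.

Definition pos n (i : 'I_n) : point n := (false, i).
Definition neg n (i : 'I_n) : point n := (true, i).
Definition opp n (x : point n) : point n := (~~ x.1, x.2).

Definition point_int n (x : point n) : int :=
  ((-1) ^+ x.1 * Posz x.2.+1)%R.

(* Composition of functions: (perm_comp f g) x = f (g x), whereas             *)
(* (f * g) x = g (f x) in MathComp.                                           *)
Definition perm_comp n (f g : {perm point n}) : {perm point n} := g * f.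

Definition WD n : {set {perm point n}} :=
  [set w : {perm point n} | [forall x, w (opp x) == opp (w x)]
         & ~~ odd #|[set i : 'I_n | (w (pos i)).1]| ].

(* [gen i] is the generator s_(i+1). For n >= 2, [ordS i] is i + 1 when i = 0 *)
(* and [ord_pred i] is i - 1 when i > 0.                                      *)
Definition gen n (i : 'I_n) : {perm point n} :=
  if i == 0%N :> nat then
    perm_comp (tperm (pos i) (neg (ordS i))) (tperm (neg i) (pos (ordS i)))
  else
    perm_comp (tperm (pos (ord_pred i)) (pos i))
              (tperm (neg (ord_pred i)) (neg i)).

Definition word n (e : seq 'I_n) : {perm point n} :=
  foldr (fun i w => perm_comp (gen i) w) 1 e.

Definition reduced_expr n (w : {perm point n}) (e : seq 'I_n) : Prop :=
  word e = w /\ forall e', word e' = w -> size e <= size e'.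

Definition has_length n (w : {perm point n}) (l : nat) : Prop :=
  exists2 e, reduced_expr w e & size e = l.

Definition supp n (w : {perm point n}) (i : 'I_n) : Prop :=
  exists2 e, reduced_expr w e & i \in e.

(* The empty product is allowed. *)
Definition commuting_product n (P : 'I_n -> Prop) (w : {perm point n}) : Prop :=
  exists e : seq 'I_n,
    [/\ {in e, forall i, P i},
        {in e &, forall i j, commute (gen i) (gen j)} & w = word e].

Definition bad n (w : {perm point n}) : Prop :=
  [/\ w \in WD n,
      ~ commuting_product (fun _ => True) w,
      forall i j e, reduced_expr w (i :: j :: e) -> commute (gen i) (gen j)
    & forall i j e, reduced_expr w (e ++ [:: i; j]) ->
        commute (gen i) (gen j)].

Definition longest_bad n (w : {perm point n}) : Prop :=
  bad w /\ exists2 l, has_length w l &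
    forall (v : {perm point n}) m, bad v -> has_length v m -> m <= l.

(* For m even, the signed permutation w_m as a map on points: with I = i + 1, *)
(* the image index m + 2 - I becomes m - i after the shift. The default value *)
(* of [insubd] is used only if m > n.                                         *)
Definition wm_even_fun n (m : nat) (x : point n) : point n :=
  let: (b, i) := x in
  let I := i.+1 in
  if m < I then (b, i)
  else if I == 1%N then (b (+) odd m./2, i)
  else if odd I then (b, i)
  else (~~ b, insubd i (m - i)).

Lemma wm_even_funK n m : ~~ odd m -> involutive (@wm_even_fun n m).
Proof.
move=> m_even [b i]; rewrite /wm_even_fun /=.
case: (ltnP m i.+1) => [-> // | le_im] /=.
case: eqP => [i0 | /eqP i0] /=.
  by rewrite ltnNge le_im i0 /= -addbA addbb addbF.
case: ifP => i_odd /=; first by rewrite ltnNge le_im (negPf i0) i_odd.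
have i_gt0 : 0 < i by rewrite lt0n -eqSS.
rewrite negbK val_insubd; case: (ltnP (m - i) n) => [lt_n | le_n].
  rewrite ltnNge ltn_subrL i_gt0 (leq_ltn_trans _ le_im) //=.
  rewrite eqSS subn_eq0 leqNgt le_im /= oddB 1?ltnW // (negPf m_even) /= i_odd.
  congr (_, _); apply: val_inj.
  by rewrite val_insubd subKn ?ltn_ord // ltnW.
rewrite ltnNge le_im (negPf i0) i_odd /=; congr (_, _); apply: val_inj.
by rewrite !val_insubd !(leq_gtF le_n).
Qed.

Lemma even_part m : ~~ odd (m - odd m).
Proof.
by case: m => [|m] //=; case: (boolP (odd m)); rewrite ?subn1 ?subn0 //= => ->.
Qed.

Definition wm n (m : nat) : {perm point n} :=
  perm (inv_inj (@wm_even_funK n (m - odd m) (even_part m))).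

Lemma wm_oneline n m (i : 'I_n) (I := i.+1) : m <= n -> ~~ odd m ->
  point_int (wm n m (pos i)) =
    if m < I then Posz I
    else if I == 1%N then ((-1) ^+ m./2)%R
    else if odd I then Posz I
    else (- Posz (m + 2 - I))%R.
Proof.
move=> le_mn m_even; rewrite permE (negPf m_even) subn0 /I /=.
rewrite /point_int; case: ltnP => [_ | le_im] /=; first by rewrite GRing.mul1r.
case: eqP => [i0 | /eqP i0] /=.
  by case: i0 => ->; rewrite GRing.mulr1 GRing.signr_odd.
case: ifP => _ /=; first by rewrite GRing.mul1r.
rewrite val_insubd (_ : m - i < n) ?GRing.mulN1r; last first.
  by apply: leq_trans le_mn; rewrite ltn_subrL lt0n i0 (leq_ltn_trans _ le_im).
by rewrite addn2 subSS subSn // ltnW.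
Qed.

(* Main.v *)
(* Write points as nonzero integers in [-n, n] and let W, V be the functions
   given by w and its inverse. A reduced expression of w ends with two
   noncommuting generators exactly when w fails to be increasing on the outer
   two of the three points moved by some pair of noncommuting generators. So w
   is bad or a commuting product iff W and V both satisfy |W 1| < W 3 < W 5 < ...
   and W 2 < W 4 < ... . If |W 1| <> 1, these chains force |W 1| = |V 1| = 2.
   Otherwise W and V are negative on the same even integers 2, ..., M, so that W
   reverses them; the odd integers below M are then fixed, since W or V moving
   one of them would have to send all later odd integers to ever larger even
   ones. Beyond M, W is increasing along both parity classes, as is V, and hence
   a product of disjoint adjacent transpositions. The sign of W 1 follows from
   the parity of the number of sign changes. Finally w_(m+2) has at least two
   more inversions than w_m (each counted twice below), which exceeds what the
   commuting generators on two extra positions can contribute. *)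
From Stdlib Require Import ZArith.
Require Import Defs.
From mathcomp Require Import all_boot all_fingroup zify.
Set Implicit Arguments.
Unset Strict Implicit.
Unset Printing Implicit Defensive.
Local Open Scope Z_scope.

(* The preprocessing of MathComp's [zify] ignores [Z.modulo]. *)
Ltac zlia := intros; Z.div_mod_to_equations; lia.

(** * Tame signed permutations *)

(* One half of the description of a bad signed permutation [W] with inverse
   [V]: forbidding a noncommuting pair of generators at the end of reduced
   expressions makes [W] increase along the odd and along the even positions. *)
Record tame (n : Z) (W V : Z -> Z) : Prop := Tame {
  tame_dom : forall z, 1 <= Z.abs z <= n -> 1 <= Z.abs (W z) <= n;
  tame_opp : forall z, 1 <= Z.abs z <= n -> W (- z) = - W z;
  tameK : forall z, 1 <= Z.abs z <= n -> V (W z) = z;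
  tame_incr : forall i j, 1 <= i -> j = i + 2 -> j <= n -> W i < W j;
  tame_incr3 : 3 <= n -> - W 1 < W 3 }.

Lemma lt_step2 (f : Z -> Z) a n :
    (forall i j, a <= i -> j = i + 2 -> j <= n -> f i < f j) ->
  forall i j, a <= i -> i < j -> j <= n -> i mod 2 = j mod 2 -> f i < f j.
Proof.
move=> f_incr.
have H (k : nat) : forall i j, j = i + 2 + 2 * Z.of_nat k -> a <= i -> j <= n ->
    f i < f j.
  elim: k => [|k IHk] i j def_j a_ge j_le; first by apply: f_incr => //; lia.
  apply: (Z.lt_trans _ (f (i + 2 + 2 * Z.of_nat k))); first by apply: IHk; lia.
  by apply: f_incr; lia.
move=> i j i_ge lt_ij j_le par; apply: (H (Z.to_nat ((j - i - 2) / 2))); zlia.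
Qed.

Lemma mod2_cases z : z mod 2 = 0 \/ z mod 2 = 1.
Proof. zlia. Qed.

Section Tame.

Variables (n : Z) (W V : Z -> Z).
Hypotheses (WP : tame n W V) (VP : tame n V W).

Lemma tame_lt i j : 1 <= i -> i < j -> j <= n -> i mod 2 = j mod 2 -> W i < W j.
Proof.
exact: (lt_step2 (tame_incr WP)).
Qed.

(** At 1 and 3 this combines [W 1 < W 3] with [tame_incr3]. Hence [W] is positive at the odd
    positions from 3 on, and the absolute value matters at 1 only. *)
Lemma tame_odd_lt i j : 1 <= i -> i < j -> j <= n -> i mod 2 = 1 -> j mod 2 = 1 ->
  Z.abs (W i) < W j.
Proof.
have W3 : 3 <= n -> Z.abs (W 1) < W 3.
  move=> n_ge3; have := tame_incr3 WP n_ge3; have := @tame_lt 1 3; zlia.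
have W1 k : 3 <= k -> k <= n -> k mod 2 = 1 -> Z.abs (W 1) < W k.
  move=> k_ge k_le k_odd; have [-> | k_neq3] := Z.eq_dec k 3.
    by apply: W3; lia.
  by have := @tame_lt 3 k; zlia.
move=> i_ge1 lt_ij j_le i_odd j_odd; have [-> | i_neq1] := Z.eq_dec i 1.
  by apply: W1; zlia.
have := W1 i; have := @tame_lt i j; zlia.
Qed.

Lemma tame_eq i j : 1 <= Z.abs i <= n -> W i = j -> V j = i.
Proof. by move=> i_dom <-; apply: (tameK WP). Qed.

Lemma tame_eqN i j : 1 <= Z.abs i <= n -> W i = - j -> V j = - i.
Proof.
move=> i_dom Wi; have := tame_dom WP i_dom; rewrite Wi => j_dom.
by rewrite -[j]Z.opp_involutive (tame_opp VP) // (tame_eq i_dom Wi).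
Qed.

End Tame.

Section EvenValues.

Variables (n : Z) (W V : Z -> Z).
Hypotheses (WP : tame n W V) (VP : tame n V W).

(** If [W 1] were odd, [|W 1|] would be a later odd position at which [V] takes the value 1 or -1,
    and [|V 1|] would have to be smaller still. *)
Lemma tame1_even : 1 <= n -> Z.abs (W 1) <> 1 -> W 1 mod 2 = 0.
Proof.
move=> n_ge1 W1_neq1.
have W1_dom : 1 <= Z.abs (W 1) <= n by apply: (tame_dom WP); lia.
have V1_dom : 1 <= Z.abs (V 1) <= n by apply: (tame_dom VP); lia.
have [//|W1_odd] := mod2_cases (W 1).
have := @tame_odd_lt _ _ _ VP 1 (Z.abs (W 1)).
have [W1_ge0 | W1_lt0] := Z_le_gt_dec 0 (W 1).
  by have := tame_eq WP (i := 1) (j := Z.abs (W 1)); zlia.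
by have := tame_eqN WP VP (i := 1) (j := Z.abs (W 1)); zlia.
Qed.

(* The even values taken at the odd positions from [j] on would outrun [n]. *)
Lemma tame_runaway j : 1 <= j -> j <= n -> j mod 2 = 1 ->
  W j mod 2 = 0 -> V j mod 2 = 0 -> j + 1 <= Z.abs (W j) ->
  j + 3 <= Z.abs (V j) -> False.
Proof.
move=> j_ge1 j_le j_odd W_even V_even W_ge V_ge.
have H (k : nat) i : i = j + 2 * Z.of_nat k -> i <= n ->
    [/\ W i mod 2 = 0, V i mod 2 = 0, i + 1 <= Z.abs (W i)
      & i + 3 <= Z.abs (V i)].
  elim: k i => [|k IHk] i def_i i_le; first by rewrite (_ : i = j) //; lia.
  have [||We Ve Wge Vge] := IHk (i - 2); [lia | lia |].
  have Wlt : Z.abs (W (i - 2)) < W i by apply: (tame_odd_lt WP); zlia.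
  have Vlt : Z.abs (V (i - 2)) < V i by apply: (tame_odd_lt VP); zlia.
  have Wi_dom : 1 <= Z.abs (W i) <= n by apply: (tame_dom WP); lia.
  have Vi_dom : 1 <= Z.abs (V i) <= n by apply: (tame_dom VP); lia.
  have VWi : V (W i) = i by apply: (tameK WP); lia.
  have WVi : W (V i) = i by apply: (tameK VP); lia.
  (* An odd [W i] would be at least [i], so [V] would take the value [i] at an odd position not
     before [i], although [V i] already exceeds [i]. Likewise an odd [V i] contradicts
     [W i >= i]. *)
  have Wi_even : W i mod 2 = 0.
    have [//|Wi_odd] := mod2_cases (W i).
    have [Wi_eq | Wi_neq] := Z.eq_dec (W i) i; first by move: VWi; rewrite Wi_eq; lia.
    by have := @tame_odd_lt _ _ _ VP i (W i); zlia.
  have Vi_even : V i mod 2 = 0.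
    have [//|Vi_odd] := mod2_cases (V i).
    by have := @tame_odd_lt _ _ _ WP i (V i); zlia.
  by split=> //; zlia.
have [||_ _ _] := H (Z.to_nat ((n - j) / 2)) (j + 2 * ((n - j) / 2)); [zlia | zlia |].
have := tame_dom VP (z := j + 2 * ((n - j) / 2)); zlia.
Qed.

(** As [W] increases along the even positions, its negative values there occupy an initial segment.
    The case [M = 0] is kept apart because [n] may be negative. *)
Lemma tame_neg_even : exists M, [/\ M mod 2 = 0, 0 <= M, M <= n \/ M = 0 &
  forall j, 2 <= j -> j <= n -> j mod 2 = 0 -> (W j < 0 <-> j <= M)].
Proof.
have H (k : nat) : exists M, [/\ M mod 2 = 0, 0 <= M <= 2 * Z.of_nat k,
    M <= n \/ M = 0 & forall j, 2 <= j -> j <= n -> j <= 2 * Z.of_nat k ->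
      j mod 2 = 0 -> (W j < 0 <-> j <= M)].
  elim: k => [|k [M [M_even M_ge M_le HM]]].
    by exists 0; split; [| lia | lia | lia].
  have [ge_n | lt_n] := Z_le_gt_dec n (2 * Z.of_nat k + 1).
    by exists M; split=> [//|||j *]; [lia | lia | apply: HM; zlia].
  have [Wge0 | Wlt0] := Z_le_gt_dec 0 (W (2 * Z.of_nat k + 2)).
    exists M; split=> [//|||j *]; [lia | lia |].
    have [j_eq | j_neq] := Z.eq_dec j (2 * Z.of_nat k + 2).
      by rewrite j_eq; lia.
    by apply: HM; zlia.
  exists (2 * Z.of_nat k + 2); split=> [|||j j2 jn jk j_even]; [zlia | lia | lia |].
  have [-> | j_neq] := Z.eq_dec j (2 * Z.of_nat k + 2); first by lia.
  by have := @tame_lt _ _ _ WP j (2 * Z.of_nat k + 2); zlia.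
have [M [M_even M_ge M_le HM]] := H (Z.to_nat n).
by exists M; split=> // [|j *]; [lia | apply: HM; lia].
Qed.

End EvenValues.

Section NegativeValues.

Variables (n : Z) (W V : Z -> Z).
Hypotheses (WP : tame n W V) (VP : tame n V W).

(** Both values at 1 are even; if one of them were at least 4 in absolute value, [tame_runaway]
    would apply at position 1. *)
Lemma tame1_neq1 : 1 <= n -> Z.abs (W 1) <> 1 ->
  Z.abs (W 1) = 2 /\ Z.abs (V 1) = 2.
Proof.
move=> n_ge1 W1_neq1.
have W1_dom : 1 <= Z.abs (W 1) <= n by apply: (tame_dom WP); lia.
have V1_dom : 1 <= Z.abs (V 1) <= n by apply: (tame_dom VP); lia.
have V1_neq1 : Z.abs (V 1) <> 1.
  have := tame_eq VP (i := 1) (j := 1).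
  by have := tame_eqN VP WP (i := 1) (j := 1); lia.
have := tame1_even WP VP n_ge1 W1_neq1.
have := tame1_even VP WP n_ge1 V1_neq1.
have := @tame_runaway _ _ _ WP VP 1.
have := @tame_runaway _ _ _ VP WP 1.
zlia.
Qed.

(** A negative odd value other than -1 would make [V] negative at an odd position from 3 on, and the
    values 1 and -1 are used up at 1 and -1. *)
Lemma tame_neg_value j : Z.abs (W 1) = 1 -> 2 <= j -> j <= n -> W j < 0 ->
  W j mod 2 = 0.
Proof.
move=> W1 j_ge j_le Wj.
have Wj_dom : 1 <= Z.abs (W j) <= n by apply: (tame_dom WP); lia.
have [//|Wj_odd] := mod2_cases (W j).
have VWj : V (- W j) = - j by have := tame_eqN WP VP (i := j) (j := - W j); lia.
have [Wj1 | Wj_neq1] := Z.eq_dec (W j) (- 1).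
  move: VWj; rewrite Wj1 /=.
  have := tame_eq WP (i := 1) (j := 1).
  by have := tame_eqN WP VP (i := 1) (j := 1); lia.
have := @tame_odd_lt _ _ _ VP 1 (- W j); zlia.
Qed.

(* Consecutive values at even positions up to [M] differ by at least 2, being
   even. *)
Lemma tame_neg_lower M : Z.abs (W 1) = 1 -> M mod 2 = 0 -> M <= n ->
    (forall j, 2 <= j -> j <= n -> j mod 2 = 0 -> (W j < 0 <-> j <= M)) ->
  forall i j, 2 <= i -> i <= j -> j <= M -> i mod 2 = 0 -> j mod 2 = 0 ->
    W i <= W j - (j - i).
Proof.
move=> W1 M_even M_le HM i j i_ge le_ij le_jM i_even j_even.
have Wneg k : 2 <= k -> k <= M -> k mod 2 = 0 -> W k < 0 /\ W k mod 2 = 0.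
  move=> k_ge k_le k_even; have := HM k; split; first by lia.
  by apply: tame_neg_value; lia.
have H (k : nat) : forall a, a = j - 2 * Z.of_nat k -> 2 <= a -> W a <= W j - (j - a).
  elim: k => [|k IHk] a def_a a_ge; first by rewrite (_ : a = j); lia.
  have := IHk (a + 2); have := Wneg a; have := Wneg (a + 2).
  have := tame_incr WP (i := a) (j := a + 2); zlia.
by apply: (H (Z.to_nat ((j - i) / 2))); zlia.
Qed.

End NegativeValues.

Section SharedBound.

Variables (n : Z) (W V : Z -> Z).
Hypotheses (WP : tame n W V) (VP : tame n V W).

(** The values climb by at least 2 per even position and are at most -2 at [M], so [W 2 <= - M].
    Moreover [V] takes the negative value -2 at the even position [- W 2]. *)
Lemma tame_bound_le M N : Z.abs (W 1) = 1 -> M mod 2 = 0 -> M <= n -> 2 <= M ->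
    (forall j, 2 <= j -> j <= n -> j mod 2 = 0 -> (W j < 0 <-> j <= M)) ->
    (forall j, 2 <= j -> j <= n -> j mod 2 = 0 -> (V j < 0 <-> j <= N)) ->
  M <= - W 2 <= N.
Proof.
move=> W1 M_even M_le M_ge HM HN.
have W2_dom : 1 <= Z.abs (W 2) <= n by apply: (tame_dom WP); lia.
have W2_neg : W 2 < 0 by apply/HM; zlia.
have W2_even := tame_neg_value WP VP W1 (j := 2).
have WM_neg : W M < 0 by apply/HM; zlia.
have WM_even := tame_neg_value WP VP W1 (j := M).
have := tame_neg_lower WP VP W1 M_even M_le HM (i := 2) (j := M).
have := HN (- W 2).
have := tame_eqN WP VP (i := 2) (j := - W 2).
zlia.
Qed.

(** If [W j] is even, [V] is positive there, so [W j] lies beyond [M], which is even and at least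
    [j + 1]. If it is odd, it exceeds [j], which forces [0 < V j < j]; but below [j], [W] is
    negative at even positions and preserves the absolute value at odd ones, so it does not reach
    [j]. *)
Lemma tame_odd_jump M j : Z.abs (W 1) = 1 -> M mod 2 = 0 ->
    (forall j, 2 <= j -> j <= n -> j mod 2 = 0 -> (W j < 0 <-> j <= M)) ->
    (forall j, 2 <= j -> j <= n -> j mod 2 = 0 -> (V j < 0 <-> j <= M)) ->
    3 <= j -> j <= M -> j <= n -> j mod 2 = 1 -> W j <> j ->
    (forall i, 1 <= i -> i < j -> i mod 2 = 1 -> Z.abs (W i) = i) ->
  W j mod 2 = 0 /\ j + 3 <= W j.
Proof.
move=> W1 M_even HM HN j_ge le_jM j_le j_odd Wj_neq IHj.
have Wj_dom : 1 <= Z.abs (W j) <= n by apply: (tame_dom WP); lia.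
have Wj_gt : Z.abs (W (j - 2)) < W j by apply: (tame_odd_lt WP); zlia.
have Wj2 : Z.abs (W (j - 2)) = j - 2 by apply: IHj; zlia.
have VWj : V (W j) = j by apply: (tameK WP); lia.
have [Wj_even | Wj_odd] := mod2_cases (W j).
  by have := HN (W j); zlia.
have Vj_lt : Z.abs (V j) < V (W j) by apply: (tame_odd_lt VP); zlia.
have Vj_gt : 0 < V j by have := @tame_odd_lt _ _ _ VP 1 j; zlia.
have WVj : W (V j) = j by apply: (tameK VP); lia.
have := IHj (V j); have := HM (V j); zlia.
Qed.

End SharedBound.

Lemma tame_shape n W V : tame n W V -> tame n V W -> 1 <= n -> Z.abs (W 1) = 1 ->
  exists M, [/\ M mod 2 = 0, 0 <= M <= n,
    forall j, 2 <= j -> j <= M ->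
      W j = if j mod 2 =? 1 then j else - (M + 2 - j)
  & forall j, M < j -> j <= n -> j <> 1 -> 0 < W j].
Proof.
move=> WP VP n_ge1 W1.
have V1 : Z.abs (V 1) = 1.
  have := tame_eq WP (i := 1) (j := 1).
  by have := tame_eqN WP VP (i := 1) (j := 1); lia.
have [M [M_even M_ge M_le HM]] := tame_neg_even WP.
have [N [N_even N_ge N_le HN]] := tame_neg_even VP.
have eq_MN : M = N.
  have le_MN : 2 <= M -> M <= N.
    by move=> M_ge2; have := tame_bound_le WP VP W1 M_even _ M_ge2 HM HN; lia.
  have le_NM : 2 <= N -> N <= M.
    by move=> N_ge2; have := tame_bound_le VP WP V1 N_even _ N_ge2 HN HM; lia.
  zlia.
rewrite -{N N_even N_ge N_le}eq_MN in HN.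
have odd_gt0 j : 3 <= j -> j <= n -> j mod 2 = 1 -> 0 < W j.
  by move=> *; have := @tame_odd_lt _ _ _ WP 1 j; zlia.
exists M; split=> // [|j j_ge j_le|j lt_Mj j_le j_neq1]; first by lia.
- case: Z.eqb_spec => [j_odd | j_neq].
    have H (k : nat) : forall i, 3 <= i -> i <= M -> i <= Z.of_nat k ->
        i mod 2 = 1 -> W i = i.
      elim: k => [|k IHk] i i_ge i_le le_ik i_odd; first by lia.
      have [//|Wi_neq] := Z.eq_dec (W i) i.
      have IH a : 1 <= a -> a < i -> a mod 2 = 1 -> Z.abs (W a) = a.
        have [-> //|a_neq1] := Z.eq_dec a 1; have := IHk a; zlia.
      have IH' a : 1 <= a -> a < i -> a mod 2 = 1 -> Z.abs (V a) = a.
        have [-> //|a_neq1] := Z.eq_dec a 1.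
        by have := tame_eq WP (i := a) (j := a); have := IHk a; zlia.
      (* Both [W] and [V] jump at [i], and these jumps start the runaway. *)
      have Vi_neq : V i <> i by have := tame_eq VP (i := i) (j := i); lia.
      have := @tame_odd_jump _ _ _ WP VP M i.
      have := @tame_odd_jump _ _ _ VP WP M i.
      have := @tame_runaway _ _ _ WP VP i.
      move=> run /(_ V1 M_even HN HM)-jumpV /(_ W1 M_even HM HN)-jumpW.
      by case: (jumpV) => //; [lia..|]; case: (jumpW) => //; [lia..|]; zlia.
    by apply: (H (Z.to_nat j)); zlia.
  (* With both bounds equal to [M], [W 2] is [- M]. The minimal climb from 2 to [j] and from [j] to
     [M] then pins [W j] from below and from above. *)
  have := tame_bound_le WP VP W1 M_even _ _ HM HN.
  have := tame_neg_lower WP VP W1 M_even _ HM (i := 2) (j := j).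
  have := tame_neg_lower WP VP W1 M_even _ HM (i := j) (j := M).
  have := tame_neg_value WP VP W1 (j := M); have := HM M.
  zlia.
have [j_even | j_odd] := mod2_cases j; last by apply: odd_gt0; zlia.
have := HM j; have := tame_dom WP (z := j); lia.
Qed.

(** * Signed permutations in coordinates *)

Definition coord n (x : point n) : Z :=
  if x.1 then - Z.of_nat x.2.+1 else Z.of_nat x.2.+1.

Definition signed n (w : {perm point n}) : Prop :=
  forall x, w (opp x) = opp (w x).

Definition refl (a b z : Z) : Z :=
  if z =? a then b else if z =? b then a
  else if z =? - a then - b else if z =? - b then - a else z.

(** The generator of index [k] acts as [refl (lo k) (hi k)]. Reading s_1 as the exchange of -1 and 2
    gives all generators one form, with [lo k < hi k]. *)
Definition lo (k : nat) : Z := if k is _.+1 then Z.of_nat k else - 1.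
Definition hi (k : nat) : Z := if k is _.+1 then Z.of_nat k + 1 else 2.

Ltac refl_cases :=
  rewrite /refl;
  repeat match goal with |- context [?a =? ?b] =>
    lazymatch a with context [if _ then _ else _] => fail | _ =>
      destruct (Z.eqb_spec a b); try lia end end;
  try lia.

Lemma coord_inj n : injective (@coord n).
Proof.
move=> [[] i] [[] j]; rewrite /coord /= => eq_ij; try lia.
  by have /ord_inj-> : i = j :> nat by lia.
by have /ord_inj-> : i = j :> nat by lia.
Qed.

Lemma coord_opp n (x : point n) : coord (opp x) = - coord x.
Proof. by case: x => [[] i] //=; rewrite /coord /= Z.opp_involutive. Qed.

Lemma oppK n : involutive (@opp n).
Proof. by case=> b i; rewrite /opp negbK. Qed.

Lemma coord_dom n (x : point n) : 1 <= Z.abs (coord x) <= Z.of_nat n.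
Proof. by case: x => [[] i]; rewrite /coord /=; have := ltn_ord i; lia. Qed.

Lemma lo_hi (k : nat) : lo k < hi k.
Proof. by case: k => [|k] /=; lia. Qed.

Lemma loE (k : nat) : (0 < k)%N -> lo k = Z.of_nat k.
Proof. by case: k. Qed.

Lemma hiE (k : nat) : (0 < k)%N -> hi k = Z.of_nat k + 1.
Proof. by case: k. Qed.

Lemma lo_dom n (i : 'I_n) : (1 < n)%N -> 1 <= Z.abs (lo i) <= Z.of_nat n.
Proof. by have := ltn_ord i; case: (val i) => [|k] /=; lia. Qed.

Lemma hi_dom n (i : 'I_n) : (1 < n)%N -> 1 <= Z.abs (hi i) <= Z.of_nat n.
Proof. by have := ltn_ord i; case: (val i) => [|k] /=; lia. Qed.

Lemma reflK a b : Z.abs a <> Z.abs b -> a <> 0 -> b <> 0 -> involutive (refl a b).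
Proof. by move=> *; move=> z; refl_cases. Qed.

Lemma tperm_refl n (x y z : point n) : x.2 != y.2 ->
  coord (perm_comp (tperm x y) (tperm (opp x) (opp y)) z)
    = refl (coord x) (coord y) (coord z).
Proof.
move=> neq_xy; rewrite /perm_comp permM.
have E (u v : point n) : (coord u =? coord v) = (u == v).
  by apply/idP/eqP => [/Z.eqb_eq/coord_inj | ->] //; rewrite Z.eqb_refl.
rewrite /refl -!coord_opp !E.
have xNx : (opp x == x) = false by apply/eqP; case: (x) => [[] ?].
have yNy : (opp y == y) = false by apply/eqP; case: (y) => [[] ?].
have yNx : (opp y == x) = false by apply: contraNF neq_xy => /eqP<-.
have xNy : (opp x == y) = false by apply: contraNF neq_xy => /eqP<-.
have NyNx : (opp y == opp x) = false.
  by rewrite (inj_eq (inv_inj (@oppK n))); apply: contraNF neq_xy => /eqP->.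
case: (tpermP (opp x) (opp y) z) => [->|->|/eqP/negPf-> /eqP/negPf->].
- by rewrite xNx xNy eqxx tpermD // eq_sym ?yNx ?yNy.
- by rewrite yNx yNy NyNx eqxx tpermD // eq_sym ?xNx ?xNy.
by case: tpermP => [->|->|/eqP/negPf-> /eqP/negPf->]; rewrite ?eqxx //;
  case: eqP => // ->.
Qed.

Lemma gen_refl n (i : 'I_n) z : (1 < n)%N ->
  coord (gen i z) = refl (lo i) (hi i) (coord z).
Proof.
move=> n_gt1; rewrite /gen; have := ltn_ord i; case: eqP => [i0 | i_neq0] lt_in.
  (* [ordS] and [ord_pred] are cyclic; [n > 1] here and [i <> 0] in the other case prevent a
     wrap-around. *)
  have: ordS i = 1%N :> nat by rewrite /= i0 modn_small.
  move: (ordS i) => j j1.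
  have := @tperm_refl _ (pos i) (neg j) z; rewrite /opp /= -/(neg _) -/(pos _) => ->.
    by move: (coord z) => c; rewrite /coord /pos /neg /= j1 i0 /lo /hi /=; refl_cases.
  by apply/eqP => e; move: j1; rewrite -e i0.
have: ord_pred i = i.-1 :> nat.
  have def_i : (i + n).-1 = (i.-1 + n)%N by lia.
  by rewrite /= def_i modnDr modn_small //; lia.
move: (ord_pred i) => j jP.
have := @tperm_refl _ (pos j) (pos i) z; rewrite /opp /= -/(neg _) -/(pos _) => ->.
  by move: (coord z) => c; rewrite /coord /pos /neg /= jP;
    case: (val i) i_neq0 => // k _; congr refl; rewrite /=; lia.
by apply/eqP => e; move: jP; rewrite e; lia.
Qed.

Lemma gen_signed n (i : 'I_n) : (1 < n)%N -> signed (gen i).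
Proof.
move=> n_gt1 x; apply: coord_inj.
rewrite coord_opp !gen_refl // coord_opp; have := lo_hi i.
have := lo_dom i n_gt1; have := hi_dom i n_gt1; have := coord_dom x.
by move=> *; refl_cases.
Qed.

Lemma genK n (i : 'I_n) : (1 < n)%N -> involutive (gen i).
Proof.
move=> n_gt1 x; apply: coord_inj; rewrite !gen_refl // reflK //.
- by case: (val i) => [|k] /=; lia.
- by have := lo_dom i n_gt1; lia.
- by have := hi_dom i n_gt1; lia.
Qed.

Section Signed.

Variable n : nat.
Implicit Types (w v : {perm point n}) (i j : 'I_n).

Lemma signedM w v : signed w -> signed v -> signed (perm_comp w v).
Proof. by move=> ws vs x; rewrite /perm_comp !permM vs ws. Qed.

Lemma signedV w : signed w -> signed w^-1%g.
Proof. by move=> ws x; apply: (perm_inj (s := w)); rewrite ws !permKV. Qed.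

Lemma signed1 : signed (1%g : {perm point n}).
Proof. by move=> x; rewrite !perm1. Qed.

Lemma perm_compA (f g h : {perm point n}) :
  perm_comp f (perm_comp g h) = perm_comp (perm_comp f g) h.
Proof. by rewrite /perm_comp mulgA. Qed.

Lemma word_cat (e f : seq 'I_n) : word (e ++ f) = perm_comp (word e) (word f).
Proof.
elim: e => [|i e IHe] /=; first by rewrite /perm_comp mulg1.
by rewrite IHe perm_compA.
Qed.

Hypothesis n_gt1 : (1 < n)%N.

Lemma word_signed (e : seq 'I_n) : signed (word e).
Proof.
elim: e => [|i e IHe] /=; first exact: signed1.
by apply: signedM => //; apply: gen_signed.
Qed.

Lemma gen_mulK i w : perm_comp (gen i) (perm_comp (gen i) w) = w.
Proof. by apply/permP => x; rewrite /perm_comp !permM genK. Qed.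

Lemma genV i : (gen i)^-1%g = gen i.
Proof. by apply/permP => x; rewrite -{1}[x](genK i n_gt1) permK. Qed.

Lemma word_rev (e : seq 'I_n) : word (rev e) = (word e)^-1%g.
Proof.
elim: e => [|i e IHe] /=; first by rewrite invg1.
rewrite rev_cons -cats1 word_cat IHe /= /perm_comp mul1g invMg genV //.
Qed.

End Signed.

(* The junk value 0 is taken if [z] is not the coordinate of a point. *)
Definition act n (w : {perm point n}) (z : Z) : Z :=
  if [pick x | coord x =? z] is Some x then coord (w x) else 0.

Section Act.

Variable n : nat.
Implicit Types (w v : {perm point n}) (i j : 'I_n).
Local Notation dom z := (1 <= Z.abs z <= Z.of_nat n).

Lemma act_coord w x : act w (coord x) = coord (w x).
Proof.
rewrite /act; case: pickP => [y /Z.eqb_eq/coord_inj-> // | /(_ x)].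
by rewrite Z.eqb_refl.
Qed.

Lemma coord_surj z : dom z -> exists x : point n, coord x = z.
Proof.
move=> z_dom; have lt_zn : ((Z.abs_nat z).-1 < n)%N by lia.
by exists (z <? 0, Ordinal lt_zn); rewrite /coord /=; case: Z.ltb_spec; lia.
Qed.

Lemma act_dom w z : dom z -> dom (act w z).
Proof. by move=> /coord_surj[x <-]; rewrite act_coord; apply: coord_dom. Qed.

Lemma act_opp w z : signed w -> dom z -> act w (- z) = - act w z.
Proof.
by move=> ws /coord_surj[x <-]; rewrite -coord_opp !act_coord ws coord_opp.
Qed.

Lemma actK w z : dom z -> act w^-1%g (act w z) = z.
Proof. by move=> /coord_surj[x <-]; rewrite !act_coord permK. Qed.

Lemma actVK w z : dom z -> act w (act w^-1%g z) = z.
Proof. by move=> /coord_surj[x <-]; rewrite !act_coord permKV. Qed.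

Lemma actM w v z : dom z -> act (perm_comp w v) z = act w (act v z).
Proof. by move=> /coord_surj[x <-]; rewrite !act_coord /perm_comp permM. Qed.

Lemma act1 z : dom z -> act (1%g : {perm point n}) z = z.
Proof. by move=> /coord_surj[x <-]; rewrite act_coord perm1. Qed.

Lemma act_inj w v : signed w -> signed v ->
  (forall z, 1 <= z <= Z.of_nat n -> act w z = act v z) -> w = v.
Proof.
move=> ws vs eq_wv; apply/permP => x; apply: coord_inj; rewrite -!act_coord.
have x_dom := coord_dom x.
have [x_gt0 | x_lt0] := Z_lt_le_dec 0 (coord x); first by apply: eq_wv; lia.
rewrite -[coord x]Z.opp_involutive !(act_opp (z := - coord x)) //; try lia.
by rewrite eq_wv //; lia.
Qed.

Lemma act_lt0 w i : (act w (Z.of_nat i.+1) <? 0) = (w (pos i)).1.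
Proof.
have -> : Z.of_nat i.+1 = coord (pos i) by [].
by rewrite act_coord; case: (w (pos i)) => [[] k].
Qed.

Hypothesis n_gt1 : (1 < n)%N.

Lemma act_gen i z : dom z -> act (gen i) z = refl (lo i) (hi i) z.
Proof. by move=> /coord_surj[x <-]; rewrite act_coord gen_refl. Qed.

Lemma act_gen_lo i : act (gen i) (lo i) = hi i.
Proof. by rewrite act_gen; [rewrite /refl Z.eqb_refl | apply: lo_dom]. Qed.

Lemma act_gen_hi i : act (gen i) (hi i) = lo i.
Proof.
rewrite act_gen; last exact: hi_dom.
by rewrite /refl Z.eqb_refl; have := lo_hi i; case: Z.eqb_spec => // ->.
Qed.

End Act.

(** * Inversions and length *)

(** This is the fact that a simple reflection permutes the positive roots other than its own. The
    condition [x <> - y] excludes pairs that are not roots of type D. *)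
Lemma refl_lt (k : nat) (x y : Z) : x < y -> x <> - y -> x <> 0 -> y <> 0 ->
    (x <> lo k \/ y <> hi k) -> (x <> - hi k \/ y <> - lo k) ->
  refl (lo k) (hi k) x < refl (lo k) (hi k) y.
Proof. by case: k => [|k] /=; move=> *; refl_cases. Qed.

(* Every root is counted twice, as (x, y) and as (- y, - x). *)
Definition inversions n (w : {perm point n}) : {set point n * point n} :=
  [set p | [&& coord p.1 <? coord p.2, p.1 != opp p.2
             & coord (w p.2) <? coord (w p.1)]].

Section Inversions.

Variable n : nat.
Hypothesis n_gt1 : (1 < n)%N.
Implicit Types (w v : {perm point n}) (i j : 'I_n).
Local Notation inv2 w := #|inversions w|.

(** The condition that [w^-1] sends the simple root of [gen i] to a positive root, so that [gen i]
    on the left lengthens [w]. *)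
Definition ascent w i := act w^-1%g (lo i) < act w^-1%g (hi i).

(** By [refl_lt], [gen i] reverses only the order of images equal to [lo i] and [hi i] or to their
    negatives. The ascent says that the preimages [A] and [B] are in increasing order, so these
    pairs become inversions. *)
Lemma inversions_gen w i (A B : point n) : signed w -> ascent w i ->
    coord (w A) = lo i -> coord (w B) = hi i ->
  inversions (perm_comp (gen i) w)
    = (A, B) |: ((opp B, opp A) |: inversions w).
Proof.
move=> ws asc wA wB.
have lt_AB : coord A < coord B.
  by move: asc; rewrite /ascent -wA -wB !act_coord !permK.
have := lo_hi i; have := lo_dom i n_gt1; have := hi_dom i n_gt1.
have abs_neq : Z.abs (lo i) <> Z.abs (hi i) by case: (val i) => [|k] /=; lia.
move=> hi_d lo_d lt_lh; apply/setP => -[x y].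
have wN z z' : coord (w z) = - coord (w z') -> z = opp z'.
  by rewrite -coord_opp => /coord_inj; rewrite -ws => /perm_inj.
have wI z z' : coord (w z) = coord (w z') -> z = z'.
  by move=> /coord_inj/perm_inj.
rewrite !inE /perm_comp !permM !gen_refl //= !xpair_eqE.
have [/andP[/eqP-> /eqP->] | nAB] := boolP ((x == A) && (y == B)).
  rewrite wA wB /=; apply/and3P; split; first by apply/Z.ltb_lt.
    by apply/eqP => /(congr1 w); rewrite ws => /(congr1 (@coord n));
      rewrite coord_opp; lia.
  by apply/Z.ltb_lt; refl_cases.
have [/andP[/eqP-> /eqP->] | nBA] := boolP ((x == opp B) && (y == opp A)).
  rewrite !ws !coord_opp wA wB /=; apply/and3P; split; first by apply/Z.ltb_lt; lia.
    by apply/eqP => /(congr1 w); rewrite !ws => /(congr1 (@coord n));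
      rewrite !coord_opp; lia.
  by apply/Z.ltb_lt; refl_cases.
rewrite /=; case: Z.ltb_spec => // lt_xy; case: eqP => // neq_xy /=.
have wx := coord_dom (w x); have wy := coord_dom (w y).
have wxy : coord (w x) <> - coord (w y) by move/wN.
have wxyE : coord (w x) <> coord (w y) by move/wI => eq_xy; move: lt_xy;
  rewrite eq_xy; lia.
apply/idP/idP => /Z.ltb_lt lt_w; apply/Z.ltb_lt.
  have [// | ge_w] := Z_lt_le_dec (coord (w y)) (coord (w x)).
  have := @refl_lt i (coord (w x)) (coord (w y)).
  have [wxl | ] := Z.eq_dec (coord (w x)) (lo i).
    have [wyl | ] := Z.eq_dec (coord (w y)) (hi i); last by lia.
    case/negP: nAB; apply/andP; split; apply/eqP; apply: wI; lia.
  have [wxl | ] := Z.eq_dec (coord (w x)) (- hi i); last by lia.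
  have [wyl | ] := Z.eq_dec (coord (w y)) (- lo i); last by lia.
  by case/negP: nBA; apply/andP; split; apply/eqP; apply: wN; lia.
apply: refl_lt; try lia.
  have [wxl | ] := Z.eq_dec (coord (w x)) (hi i); last by lia.
  have [wyl | ] := Z.eq_dec (coord (w y)) (lo i); last by lia.
  have eq_xB : x = B by apply: wI; lia.
  have eq_yA : y = A by apply: wI; lia.
  by move: lt_xy; rewrite eq_xB eq_yA; lia.
have [wxl | ] := Z.eq_dec (coord (w x)) (- lo i); last by lia.
have [wyl | ] := Z.eq_dec (coord (w y)) (- hi i); last by lia.
have eq_xB : x = opp A by apply: wN; lia.
have eq_yA : y = opp B by apply: wN; lia.
by move: lt_xy; rewrite eq_xB eq_yA !coord_opp; lia.
Qed.

Lemma exists_lo_hi w i : exists A B : point n,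
  coord (w A) = lo i /\ coord (w B) = hi i.
Proof.
have [x x_lo] := coord_surj (lo_dom i n_gt1).
have [y y_hi] := coord_surj (hi_dom i n_gt1).
by exists (w^-1%g x), (w^-1%g y); rewrite !permKV.
Qed.

Lemma inv2_ascent w i : signed w -> ascent w i ->
  inv2 (perm_comp (gen i) w) = (inv2 w).+2.
Proof.
move=> ws asc; have [A [B [wA wB]]] := exists_lo_hi w i.
rewrite (inversions_gen ws asc wA wB) !cardsU1 !inE /= xpair_eqE ws wA ws wB.
have := lo_hi i; have := lo_dom i n_gt1; have := hi_dom i n_gt1.
move=> hi_d lo_d lt_lh; rewrite !coord_opp wA wB.
have -> : (hi i <? lo i) = false by apply/Z.ltb_ge; lia.
have -> : (- lo i <? - hi i) = false by apply/Z.ltb_ge; lia.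
rewrite !andbF /=; case: eqP => [eq_AB | //].
move/(congr1 w)/(congr1 (@coord n)): eq_AB; rewrite ws coord_opp wA wB.
by case: (val i) => [|k] /=; lia.
Qed.

Lemma ascent_gen w i : ~ ascent w i -> ascent (perm_comp (gen i) w) i.
Proof.
have lo_d := lo_dom i n_gt1; have hi_d := hi_dom i n_gt1.
rewrite /ascent /perm_comp invMg genV // -/(perm_comp _ _).
rewrite !actM // act_gen_lo // act_gen_hi // => asc.
have : act w^-1%g (lo i) <> act w^-1%g (hi i).
  by move/(congr1 (act w)); rewrite !actVK //; have := lo_hi i; lia.
by case/Z.lt_gt_cases => // /asc.
Qed.

Lemma inv2_descent w i : signed w -> ~ ascent w i ->
  inv2 w = (inv2 (perm_comp (gen i) w)).+2.
Proof.
move=> ws /ascent_gen asc; rewrite -(inv2_ascent _ asc) ?gen_mulK //.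
by apply: signedM => //; apply: gen_signed.
Qed.

Lemma inv2_1 : inv2 (1%g : {perm point n}) = 0%N.
Proof.
apply/eqP; rewrite cards_eq0; apply/eqP/setP => -[x y].
by rewrite !inE !perm1 /=; case: Z.ltb_spec => //= ?; apply/andP => -[_ /Z.ltb_lt]; lia.
Qed.

Lemma inv2_word (e : seq 'I_n) v : signed v ->
  (inv2 (perm_comp (word e) v) <= (size e).*2 + inv2 v)%N.
Proof.
move=> vs; elim: e => [|i e IHe] /=; first by rewrite /perm_comp mulg1.
rewrite -perm_compA; set w := perm_comp (word e) v in IHe *.
have ws : signed w by apply: signedM => //; apply: word_signed.
have [asc | /(inv2_descent ws)] := Z_lt_dec (act w^-1%g (lo i)) (act w^-1%g (hi i)).
  by rewrite (inv2_ascent ws asc) doubleS !addSn !ltnS.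
rewrite doubleS !addSn => eq_w; apply/leqW/leqW/(leq_trans _ IHe).
by rewrite eq_w; apply/leqW/leqW.
Qed.

Lemma inv2_word_le (e : seq 'I_n) : (inv2 (word e) <= (size e).*2)%N.
Proof.
have := inv2_word e (@signed1 n); rewrite inv2_1 addn0.
by rewrite /perm_comp mul1g.
Qed.

End Inversions.

(** * Parity of the number of sign changes *)

Section Parity.

Variable n : nat.
Hypothesis n_gt1 : (1 < n)%N.
Implicit Types (w v : {perm point n}) (i j : 'I_n).

Lemma WD_signed w : w \in WD n -> signed w.
Proof. by rewrite inE => /andP[/forallP ws _] x; apply/eqP. Qed.

Lemma odd_card (T : finType) (a : pred T) :
  odd #|[set x | a x]| = \big[addb/false]_x a x.
Proof.
rewrite -sum1_card (big_morph odd oddD (erefl : odd 0 = false)) big_mkcond.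
by apply: eq_bigr => x _; rewrite inE; case: (a x).
Qed.

Lemma signed_inj w i j : signed w -> (w (pos i)).2 = (w (pos j)).2 -> i = j.
Proof.
move=> ws; case Ei: (w (pos i)) => [b k]; case Ej: (w (pos j)) => [c l] /= eq_kl.
have [eq_bc | neq_bc] := eqVneq b c.
  by have /perm_inj[] : w (pos i) = w (pos j) by rewrite Ei Ej eq_kl eq_bc.
have /perm_inj[//] : w (pos i) = w (opp (pos j)).
by rewrite ws Ei Ej eq_kl /opp /=; case: (b) (c) neq_bc => [] [].
Qed.

Lemma gen_sign i (x : point n) :
  (gen i x).1 = x.1 (+) ((i == 0%N :> nat) && (x.2 < 2)%N).
Proof.
have sgn (y : point n) : y.1 = (coord y <? 0) by case: y => [[] k].
have -> : (x.2 < 2)%N = (Z.abs (coord x) <=? 2).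
  by case: x => [[] k]; rewrite /coord /=; case: Z.leb_spec; lia.
rewrite !sgn gen_refl //; have := coord_dom x.
by case: (val i) => [|k] /= ?; case: (Z.leb_spec (Z.abs (coord x)) 2) => ?;
  rewrite /= ?addbF ?addbT; refl_cases; do ![case: Z.ltb_spec => ?]; lia.
Qed.

Lemma gen_WD w i : w \in WD n -> perm_comp (gen i) w \in WD n.
Proof.
move=> wD; have ws := WD_signed wD; move: wD; rewrite !inE => /andP[_ w_even].
apply/andP; split.
  by apply/forallP => x; rewrite (signedM (gen_signed i n_gt1) ws).
rewrite odd_card; under eq_bigr do rewrite /perm_comp permM gen_sign.
rewrite big_split -odd_card (negPf w_even) /=.
have [i0 | i_neq0] := boolP (i == 0%N :> nat); last by rewrite big1.
(* The indices of the images form a permutation, so exactly two of them lie below 2, and [gen i]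
   flips exactly these two signs. *)
have f_inj : injective (fun j => (w (pos j)).2) by move=> j k; apply: signed_inj.
rewrite -(odd_card (fun j => (w (pos j)).2 < 2)%N).
have -> : [set j | ((w (pos j)).2 < 2)%N]
    = (fun j => (w (pos j)).2) @^-1: [set j : 'I_n | (j < 2)%N].
  by apply/setP => j; rewrite !inE.
rewrite on_card_preimset; last exact/onW_bij/injF_bij.
have -> : [set j : 'I_n | (j < 2)%N] = [set Ordinal (ltnW n_gt1); Ordinal n_gt1].
  by apply/setP => -[[|[|k]] lt_kn]; rewrite !inE -!val_eqE.
by rewrite cards2.
Qed.

Lemma WD1 : 1%g \in WD n.
Proof.
rewrite inE; apply/andP; split; first by apply/forallP => x; rewrite !perm1.
by rewrite odd_card big1 // => i; rewrite perm1.
Qed.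

(* The number of sign changes being even, one sign is determined by the
   others. *)
Lemma WD_sign w v i0 : w \in WD n -> v \in WD n ->
    (forall i, i != i0 -> (w (pos i)).1 = (v (pos i)).1) ->
  (w (pos i0)).1 = (v (pos i0)).1.
Proof.
rewrite !inE !odd_card => /andP[_ w_even] /andP[_ v_even] eq_wv.
move: w_even v_even; rewrite !(bigD1 (P := xpredT) i0) //=.
rewrite (eq_bigr _ eq_wv); move: (\big[_/_]_(i | _) _) => b.
by case: (w _).1 (v _).1 b => [] [] [].
Qed.

(** The ascents say that [|V 1| < V 2 < V 3 < ...]. Counting up from 2 and down from [n] squeezes
    [V z] to [z] for [z >= 2]; parity settles the sign at 1. *)
Lemma no_descent w : w \in WD n -> (forall i, ascent w i) -> w = 1%g.
Proof.
move=> wD asc; have ws := WD_signed wD; have vs := signedV ws.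
set V := act w^-1%g in asc.
have V12 : Z.abs (V 1) < V 2.
  have := asc (Ordinal (ltnW n_gt1)); rewrite /ascent /= -/V.
  have := asc (Ordinal n_gt1); rewrite /ascent /= -/V.
  by rewrite /V (act_opp (z := 1)) //; lia.
have Vlt z : 2 <= z -> z + 1 <= Z.of_nat n -> V z < V (z + 1).
  move=> z_ge z_lt; have lt_zn : (Z.to_nat z < n)%N by lia.
  have := asc (Ordinal lt_zn); rewrite /ascent.
  have -> : lo (Ordinal lt_zn) = z by rewrite loE /=; lia.
  have -> : hi (Ordinal lt_zn) = z + 1 by rewrite hiE /=; lia.
  by [].
have V1_dom : 1 <= Z.abs (V 1) <= Z.of_nat n by apply: act_dom; lia.
have Vge (k : nat) : Z.of_nat k + 2 <= Z.of_nat n ->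
    Z.of_nat k + 2 <= V (Z.of_nat k + 2).
  elim: k => [|k IHk] k_le; first by rewrite /=; lia.
  have := Vlt (Z.of_nat k + 2).
  rewrite (_ : Z.of_nat k + 2 + 1 = Z.of_nat k.+1 + 2); lia.
have Vle (k : nat) : 2 <= Z.of_nat n - Z.of_nat k ->
    V (Z.of_nat n - Z.of_nat k) <= Z.of_nat n - Z.of_nat k.
  elim: k => [|k IHk] k_le.
    have : 1 <= Z.abs (V (Z.of_nat n)) <= Z.of_nat n by apply: act_dom; lia.
    by rewrite Z.sub_0_r; lia.
  have := Vlt (Z.of_nat n - Z.of_nat k.+1).
  rewrite (_ : Z.of_nat n - Z.of_nat k.+1 + 1 = Z.of_nat n - Z.of_nat k); lia.
have V_id z : 2 <= z -> z <= Z.of_nat n -> V z = z.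
  move=> z_ge z_le; have := Vge (Z.to_nat (z - 2));
    have := Vle (Z.to_nat (Z.of_nat n - z)).
  rewrite (_ : Z.of_nat n - _ = z); last by lia.
  by rewrite (_ : Z.of_nat (Z.to_nat (z - 2)) + 2 = z); lia.
have W_id z : 2 <= z -> z <= Z.of_nat n -> act w z = z.
  by move=> z_ge z_le; rewrite -{1}(V_id z) // actVK //; lia.
have V1 : Z.abs (V 1) = 1 by have := V_id 2; lia.
have W1 : act w 1 = 1.
  have w0 : (w (pos (Ordinal (ltnW n_gt1)))).1 = false.
    rewrite (WD_sign wD WD1) ?perm1 // => i; rewrite -val_eqE /= => i_neq0.
    by rewrite perm1 -act_lt0 W_id; [apply/Z.ltb_ge | | have := ltn_ord i]; lia.
  have [V_pos | V_neg] := Z.abs_spec (V 1).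
    by have := @actVK _ w 1; rewrite -/V (_ : V 1 = 1); lia.
  move: w0; rewrite -act_lt0 (_ : Z.of_nat _ = 1) // => /Z.ltb_ge.
  have : act w (- V 1) = - 1.
    by rewrite act_opp // /V actVK //; lia.
  by rewrite (_ : - V 1 = 1); lia.
apply: act_inj => // [|z z_ge]; first exact: signed1.
have [-> | z_neq1] := Z.eq_dec z 1; first by rewrite W1 act1 //; lia.
by rewrite W_id ?act1; lia.
Qed.

End Parity.

(** * Reduced expressions *)

Section Reduced.

Variable n : nat.
Hypothesis n_gt1 : (1 < n)%N.
Implicit Types (w v : {perm point n}) (i j : 'I_n) (e : seq 'I_n).
Local Notation inv2 w := #|inversions w|.

(** Stripping descents from the left removes two counted inversions each time and stops only at the
    identity, by [no_descent]. *)
Lemma exists_word w : w \in WD n -> exists e, word e = w /\ (size e).*2 = inv2 w.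
Proof.
have [k] := ubnP (inv2 w); elim: k w => // k IHk w le_wk wD.
have ws := WD_signed wD.
have [/forallP asc | ] :=
    boolP [forall i : 'I_n, act w^-1%g (lo i) <? act w^-1%g (hi i)].
  exists [::]; rewrite (no_descent n_gt1 wD) ?inv2_1 // => i.
  exact/Z.ltb_lt/asc.
rewrite negb_forall => /existsP[i /negP desc].
have {}desc : ~ ascent w i by move=> asc; apply: desc; apply/Z.ltb_lt.
have inv_w := inv2_descent n_gt1 ws desc.
have [||e [def_e size_e]] := IHk (perm_comp (gen i) w).
- by rewrite inv_w ltnS in le_wk; apply: ltnW.
- exact: gen_WD.
by exists (i :: e); rewrite /= def_e gen_mulK // inv_w -size_e doubleS.
Qed.

Lemma reduced_exprP w e : w \in WD n ->
  reduced_expr w e <-> word e = w /\ (size e).*2 = inv2 w.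
Proof.
move=> wD; have [e0 [def_e0 size_e0]] := exists_word wD.
split=> [[def_e min_e] | [def_e size_e]]; split=> //.
  apply/eqP; rewrite eqn_leq -{2}def_e inv2_word_le // -size_e0 leq_double.
  by rewrite min_e.
by move=> f def_f; rewrite -leq_double size_e -def_f inv2_word_le.
Qed.

Lemma has_lengthP w l : w \in WD n -> has_length w l <-> l.*2 = inv2 w.
Proof.
move=> wD; split=> [[e /(reduced_exprP _ wD)[_ <-] <-] // | def_l].
have [e [def_e size_e]] := exists_word wD.
by exists e; [apply/reduced_exprP | apply: double_inj; rewrite size_e].
Qed.

Lemma WDV w : w \in WD n -> w^-1%g \in WD n.
Proof.
move=> wD; have [e [<- _]] := exists_word wD; rewrite -word_rev //.
elim: (rev e) => [|i f IHf] /=; first exact: WD1.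
exact: gen_WD.
Qed.

Lemma reduced_exprV w e : reduced_expr w e -> reduced_expr w^-1%g (rev e).
Proof.
move=> [<- min_e]; split=> [|f def_f]; first exact: word_rev.
rewrite size_rev -(size_rev f) min_e // word_rev // def_f invgK //.
Qed.

End Reduced.

(** * Bad elements as monotone signed permutations *)

Section Bad.

Variable n : nat.
Hypothesis n_gt1 : (1 < n)%N.
Implicit Types (w v : {perm point n}) (i j : 'I_n) (e : seq 'I_n).
Local Notation inv2 w := #|inversions w|.

Lemma commute_gen i j : hi i <> lo j -> hi j <> lo i -> commute (gen i) (gen j).
Proof.
move=> nij nji; apply/permP => x; apply: coord_inj; rewrite !permM !gen_refl //.
have := coord_dom x; move: nij nji (coord x).
case: (val i) => [|k]; case: (val j) => [|l] /= nij nji c c_dom; refl_cases.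
Qed.

Lemma refl_lo (k l : nat) : hi k = lo l -> refl (lo l) (hi l) (lo k) = lo k.
Proof. by case: k => [|k]; case: l => [|l] /= eq_kl; refl_cases. Qed.

Lemma refl_hi (k l : nat) : hi k = lo l -> refl (lo k) (hi k) (hi l) = hi l.
Proof. by case: k => [|k]; case: l => [|l] /= eq_kl; refl_cases. Qed.

Lemma noncommute_gen i j : hi i = lo j -> ~ commute (gen i) (gen j).
Proof.
move=> eq_ij; have lo_d := lo_dom i n_gt1; have hi_d := hi_dom i n_gt1.
move=> /(congr1 (fun f => act f (lo i))).
rewrite -[X in X = _]/(act (perm_comp (gen j) (gen i)) _).
rewrite -[X in _ = X]/(act (perm_comp (gen i) (gen j)) _) !actM //.
rewrite (act_gen n_gt1 j lo_d) refl_lo // !act_gen_lo // eq_ij act_gen_lo //.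
by have := lo_hi j; lia.
Qed.

Lemma actV_gen i w z : 1 <= Z.abs z <= Z.of_nat n ->
  act (perm_comp (gen i) w)^-1%g z = act w^-1%g (act (gen i) z).
Proof. by move=> z_dom; rewrite /perm_comp invMg genV // -/(perm_comp _ _) actM. Qed.

Lemma act_neq w a b : 1 <= Z.abs a <= Z.of_nat n ->
  1 <= Z.abs b <= Z.of_nat n -> a <> b -> act w a <> act w b.
Proof. by move=> a_d b_d neq /(congr1 (act w^-1%g)); rewrite !actK. Qed.

Lemma two_descents w i j : w \in WD n -> ~ ascent w i ->
  ~ ascent (perm_comp (gen i) w) j -> exists e, reduced_expr w (i :: j :: e).
Proof.
move=> wD desc_i desc_j; have w1D := gen_WD n_gt1 i wD.
have w2D := gen_WD n_gt1 j w1D; have [e [def_e size_e]] := exists_word n_gt1 w2D.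
exists e; apply/reduced_exprP => //; rewrite /= def_e !gen_mulK //; split=> //.
rewrite (inv2_descent n_gt1 (WD_signed wD) desc_i).
by rewrite (inv2_descent n_gt1 (WD_signed w1D) desc_j) -size_e !doubleS.
Qed.

(* [hi i = lo j] holds iff gen i and gen j do not commute, up to exchanging
   [i] and [j]; then [lo i < hi i < hi j] are permuted by gen i and gen j. *)
Definition incr3 w := forall i j, hi i = lo j -> act w (lo i) < act w (hi j).

Definition commuting_start w :=
  forall i j e, reduced_expr w (i :: j :: e) -> commute (gen i) (gen j).

(** If [w] starts with noncommuting [gen i] and [gen j], these carry the outer two of their three
    points to the pair of [gen j] in reverse order, and the rest of the word ascends there.
    Conversely, outer points in the wrong order give two successive descents. *)
Lemma incr3_commuting_start w : w \in WD n ->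
  incr3 w^-1%g <-> commuting_start w.
Proof.
move=> wD; have ws := WD_signed wD; split=> [incr i j e | comm i j eq_ij].
  case/(reduced_exprP n_gt1 _ wD) => def_w size_e; rewrite /= in def_w size_e.
  set v := word e in def_w; have vs : signed v by apply: word_signed.
  (* Otherwise [w] would have at most [(size e).*2] counted inversions, 4 fewer than a reduced
     expression requires. *)
  have asc : ascent v j.
    have [//|desc] := Z_lt_dec (act v^-1%g (lo j)) (act v^-1%g (hi j)).
    have inv_v := inv2_descent n_gt1 vs desc.
    have := inv2_word n_gt1 [:: i] (signedM (gen_signed j n_gt1) vs).
    have := inv2_word_le n_gt1 e; rewrite -/v inv_v /= /perm_comp !mul1g.
    rewrite -/(perm_comp _ _) -/(perm_comp (gen i) _) def_w -size_e.
    by move: #|_| => a; lia.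
  have loi := lo_dom i n_gt1; have hij := hi_dom j n_gt1.
  have loj := lo_dom j n_gt1; have hii := hi_dom i n_gt1.
  have [eq_ij | neq_ij] := Z.eq_dec (hi i) (lo j).
    have := incr i j eq_ij; rewrite -def_w !actV_gen //; try exact: act_dom.
    rewrite act_gen_lo // (act_gen n_gt1 i hij) refl_hi // eq_ij act_gen_lo //
      act_gen_hi //.
    by move: asc; rewrite /ascent; lia.
  have [eq_ji | neq_ji] := Z.eq_dec (hi j) (lo i); last exact: commute_gen.
  have := incr j i eq_ji; rewrite -def_w !actV_gen //; try exact: act_dom.
  rewrite act_gen_hi // (act_gen n_gt1 i loj) refl_lo // -eq_ji act_gen_lo //
    act_gen_hi //.
  by move: asc; rewrite /ascent; lia.
have loi := lo_dom i n_gt1; have hij := hi_dom j n_gt1.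
have loj := lo_dom j n_gt1; have hii := hi_dom i n_gt1.
have [//|ge_ij] := Z_lt_dec (act w^-1%g (lo i)) (act w^-1%g (hi j)).
have neq_ij : act w^-1%g (lo i) <> act w^-1%g (hi j).
  by apply: act_neq => //; have := lo_hi i; have := lo_hi j; lia.
(* The value at the middle point decides whether [gen i] or [gen j] is stripped first; the second
   descent then compares the values at the outer points. *)
exfalso; have [asc | desc] := Z_lt_dec (act w^-1%g (lo j)) (act w^-1%g (hi j)).
  have [||e /comm/(noncommute_gen eq_ij)//] := @two_descents w i j wD.
    by rewrite /ascent eq_ij; lia.
  rewrite /ascent !actV_gen // -eq_ij act_gen_hi // (act_gen n_gt1 i hij) refl_hi //.
have [||e /comm/commute_sym/(noncommute_gen eq_ij)//] := @two_descents w j i wD.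
  by [].
rewrite /ascent !actV_gen // eq_ij act_gen_lo // (act_gen n_gt1 j loi) refl_lo //.
Qed.

(** Reversing reduced expressions passes to [w^-1] and turns the condition on ends into the one on
    starts. *)
Lemma badP w : bad w <-> [/\ w \in WD n, ~ commuting_product (fun=> True) w,
  incr3 w & incr3 w^-1%g].
Proof.
split=> [[wD ncomm start_w end_w] | [wD ncomm incr incrV]]; have vD := WDV n_gt1 wD.
  split=> //; last exact/incr3_commuting_start.
  rewrite -[w]invgK; apply/incr3_commuting_start => // i j e.
  move/(reduced_exprV n_gt1); rewrite invgK -cat1s -[j :: e]cat1s !rev_cat -catA.
  by move/end_w/commute_sym.
split=> //; first exact/incr3_commuting_start.
move=> i j e /(reduced_exprV n_gt1); rewrite rev_cat.
by rewrite -[w]invgK in incr;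
  move/incr3_commuting_start: incr => /(_ vD) start /start/commute_sym.
Qed.

Lemma incr3_tame w : signed w -> incr3 w ->
  tame (Z.of_nat n) (act w) (act w^-1%g).
Proof.
move=> ws incr; split=> [z|z|z|i j i_ge -> i_le|n_ge].
- exact: act_dom.
- exact: act_opp.
- exact: actK.
- have lt_i : (Z.to_nat i < n)%N by lia.
  have lt_i1 : ((Z.to_nat i).+1 < n)%N by lia.
  have lo_i : lo (Ordinal lt_i) = i by rewrite loE /=; lia.
  have hi_i : hi (Ordinal lt_i) = i + 1 by rewrite hiE /=; lia.
  have lo_i1 : lo (Ordinal lt_i1) = i + 1 by rewrite loE /=; lia.
  have hi_i1 : hi (Ordinal lt_i1) = i + 2 by rewrite hiE /=; lia.
  by have := incr (Ordinal lt_i) (Ordinal lt_i1); rewrite lo_i hi_i lo_i1 hi_i1; apply.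
have lt_2n : (2 < n)%N by lia.
(* The generators of indices 0 and 2 act on the three points -1, 2, 3. *)
have := incr (Ordinal (ltnW n_gt1)) (Ordinal lt_2n) erefl.
have opp1 : act w (- 1) = - act w 1 by apply: (act_opp (z := 1)) => //; lia.
by rewrite /= opp1.
Qed.

(** Each generator moves two consecutive absolute values. Commuting generators have equal or
    disjoint such blocks (indices 0 and 1 share the block of 1 and 2), so no point leaves its block.
    This keeps [wm n n] from being a commuting product. *)
Lemma commuting_word_near e z : {in e &, forall i j, commute (gen i) (gen j)} ->
    1 <= Z.abs z <= Z.of_nat n ->
  Z.abs (Z.abs (act (word e) z) - Z.abs z) <= 1.
Proof.
move=> comm z_dom.
have block : Z.abs (act (word e) z) = Z.abs z \/ exists2 i, i \in e &
    (Z.abs z = Z.abs (lo i) \/ Z.abs z = Z.abs (hi i)) /\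
    (Z.abs (act (word e) z) = Z.abs (lo i) \/ Z.abs (act (word e) z) = Z.abs (hi i)).
  elim: e comm => [|j e IHe] comm /=; first by left; rewrite act1.
  rewrite actM // act_gen //; last exact: act_dom.
  set y := act (word e) z in IHe *.
  have [yj | nyj] : (Z.abs y = Z.abs (lo j) \/ Z.abs y = Z.abs (hi j))
      \/ refl (lo j) (hi j) y = y by refl_cases.
    have rj : Z.abs (refl (lo j) (hi j) y) = Z.abs (lo j)
        \/ Z.abs (refl (lo j) (hi j) y) = Z.abs (hi j) by refl_cases.
    right; exists j; first exact: mem_head.
    case: IHe => [i k i_e k_e | <- // | [i i_e [zi yi]]].
      by apply: comm; rewrite inE ?i_e ?k_e orbT.
    have neq_ij : hi i <> lo j.
      move=> /noncommute_gen; apply; apply: comm; rewrite inE ?i_e ?eqxx ?orbT //.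
    have neq_ji : hi j <> lo i.
      move=> /noncommute_gen; apply; apply: comm; rewrite inE ?i_e ?eqxx ?orbT //.
    split=> //; move: neq_ij neq_ji zi yi yj.
    by case: (val i) => [|k]; case: (val j) => [|l] /=; lia.
  rewrite nyj; case: IHe => [i k i_e k_e | -> | [i i_e yi]]; [|by left|].
    by apply: comm; rewrite inE ?i_e ?k_e orbT.
  by right; exists i => //; rewrite inE i_e orbT.
by case: block => [|[i _ []]]; [lia | case: (val i) => [|k] /=; lia].
Qed.

End Bad.

(** * The elements [wm n m] *)

Lemma inversionsP n (w : {perm point n}) x y :
  reflect [/\ coord x < coord y, coord x <> - coord y
            & act w (coord y) < act w (coord x)] ((x, y) \in inversions w).
Proof.
rewrite inE /= !act_coord;
  apply: (iffP and3P) => [[/Z.ltb_lt ? /eqP neq /Z.ltb_lt ?]|[? neq ?]].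
  by split=> //; rewrite -coord_opp => /coord_inj.
split; try exact/Z.ltb_lt.
by apply/eqP => eq_xy; apply: neq; rewrite eq_xy coord_opp.
Qed.

Section Wm.

Variable n : nat.
Hypothesis n_gt1 : (1 < n)%N.
Implicit Types (w v : {perm point n}) (i j : 'I_n) (e : seq 'I_n) (m : nat).
Local Notation inv2 w := #|inversions w|.
Local Notation dom z := (1 <= Z.abs z <= Z.of_nat n).

Lemma wm_even_part m : wm n m = wm n (m - odd m).
Proof. by apply/permP => x; rewrite !permE (negPf (even_part m)) subn0. Qed.

Lemma wmV m : (wm n m)^-1%g = wm n m.
Proof.
apply/permP => x; apply: (perm_inj (s := wm n m)).
by rewrite permKV !permE wm_even_funK // even_part.
Qed.

Lemma wm_signed m : signed (wm n m).
Proof.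
case=> b i; rewrite !permE /opp /wm_even_fun /=; move: (m - odd m)%N => {}m.
case: ltnP => // _; case: eqP => _ /=; first by rewrite addNb.
by case: ifP.
Qed.

Lemma wm0 : wm n 0 = 1%g.
Proof. by apply/permP => -[b i]; rewrite permE perm1. Qed.

Lemma act_wmK m z : dom z -> act (wm n m) (act (wm n m) z) = z.
Proof. by move=> z_dom; rewrite -{1}wmV actK. Qed.

Lemma wm_sign m i : ~~ odd m -> (wm n m (pos i)).1 =
  (i < m)%N && (if i == 0%N :> nat then odd m./2 else odd i).
Proof.
move=> m_even; rewrite permE /wm_even_fun (negPf m_even) subn0 /= eqSS.
by case: ltnP => //= _; case: eqP => //= _; case: (odd i).
Qed.

Lemma wm_WD m : (m <= n)%N -> ~~ odd m -> wm n m \in WD n.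
Proof.
move=> le_mn m_even; rewrite inE; apply/andP; split.
  by apply/forallP => x; rewrite wm_signed.
rewrite odd_card; under eq_bigr do rewrite wm_sign //.
rewrite -(big_mkord xpredT (fun i : nat => (i < m)%N && (if i == 0%N then odd
  m./2 else odd i))).
rewrite (big_cat_nat (n := m)) //= [X in _ (+) X]big_nat_cond [X in _ (+) X]big1;
  last first.
  by move=> i; rewrite andbT => /andP[le_mi _]; rewrite ltnNge le_mi.
(* There are [k./2] odd indices below [k]; the sign at index 0 compensates for the parity of this
   number. *)
have odd_sum k : \big[addb/false]_(0 <= i < k) odd i = odd k./2.
  elim: k => [|k IHk]; first by rewrite big_nil.
  by rewrite big_nat_recr //= IHk uphalf_half oddD oddb addbC.
case: m le_mn m_even odd_sum => [|m] le_mn m_even odd_sum; first by rewrite big_nil.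
move: (odd_sum m.+1); rewrite !big_nat_recl //= => <-.
rewrite addbF [X in _ (+) X](eq_big_nat _ _ (F2 := fun i : nat => odd i.+1)) ?addbb //.
by move=> i /andP[_ lt_im]; rewrite ltnS lt_im.
Qed.

Lemma act_wm_spec m z : (m <= n)%N -> ~~ odd m -> dom z ->
  act (wm n m) z = z /\ (Z.of_nat m < Z.abs z \/ 3 <= Z.abs z /\ z mod 2 = 1)
  \/ Z.abs z = 1 /\ Z.abs (act (wm n m) z) = 1
  \/ 2 <= z <= Z.of_nat m /\ z mod 2 = 0
    /\ act (wm n m) z = - (Z.of_nat m + 2 - z)
  \/ 2 <= - z <= Z.of_nat m /\ z mod 2 = 0
    /\ act (wm n m) z = Z.of_nat m + 2 + z.
Proof.
move=> le_mn m_even /coord_surj[[b i] <-].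
rewrite act_coord permE /wm_even_fun (negPf m_even) subn0 eqSS.
case: ltnP => [lt_mi | le_im].
  by left; split=> //; left; rewrite /coord; case: b => /=; lia.
case: eqP => [i0 | i_neq0].
  by right; left; rewrite /coord; case: b => /=; rewrite i0; case: (odd _) => /=; lia.
case: ifP => /= [i_even | i_odd].
  by left; split=> //; right; rewrite /coord; case: b => /=; zlia.
have val_i : insubd i (m - i)%N = (m - i)%N :> nat.
  by rewrite val_insubd (_ : m - i < n)%N //; lia.
by right; right; case: b; [right | left]; rewrite /coord /= val_i; zlia.
Qed.

(** For [m = 0] this also settles the points 1 and -1, whose signs [act_wm_spec] leaves open. *)
Lemma act_wm_fixed m z : (m <= n)%N -> ~~ odd m -> dom z ->
  Z.of_nat m < Z.abs z -> act (wm n m) z = z.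
Proof.
move=> le_mn m_even z_dom lt_mz.
have lt_mi : exists b (i : 'I_n), coord (b, i) = z /\ (m < i.+1)%N.
  have [[b i] def_z] := coord_surj z_dom; exists b, i; split=> //.
  by move: lt_mz; rewrite -def_z; case: (b); rewrite /coord /=; lia.
have [b [i [<- {}lt_mi]]] := lt_mi.
by rewrite act_coord permE /wm_even_fun (negPf m_even) subn0 lt_mi.
Qed.

(** The point [m + 2], formerly fixed, goes to -2, below the images of 1 and -1. This creates two
    inverted roots, each counted twice, and no old inversion is lost. *)
Lemma inv2_wm_step m : ~~ odd m -> (m.+2 <= n)%N ->
  (inv2 (wm n m) + 4 <= inv2 (wm n m.+2))%N.
Proof.
move=> m_even le_mn; have m2_even : ~~ odd m.+2 by rewrite /= negbK.
have lt_0n : (0 < n)%N by lia.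
have lt_1n : (m.+1 < n)%N by lia.
pose a : point n := pos (Ordinal lt_0n); pose t : point n := pos (Ordinal lt_1n).
pose S := [set (a, t); (opp a, t); (opp t, a); (opp t, opp a)].
have cardS : #|S| = 4%N.
  by rewrite /S -!setUA !cardsU1 cards1 !inE /a /t /opp /pos !xpair_eqE /= !andbF.
have le_mn' : (m <= n)%N by lia.
pose W := act (wm n m); pose W' := act (wm n m.+2).
have W_spec z := act_wm_spec (z := z) le_mn' m_even; rewrite -/W in W_spec.
have W'_spec z := act_wm_spec (z := z) le_mn m2_even; rewrite -/W' in W'_spec.
have t_dom : dom (coord t) by apply: coord_dom.
have a_dom : dom (coord a) by apply: coord_dom.
have ca : coord a = 1 by [].
have ct : coord t = Z.of_nat m + 2 by rewrite /coord /=; lia.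
have W_t : W (Z.of_nat m + 2) = Z.of_nat m + 2 by apply: act_wm_fixed; lia.
have W_Nt : W (- (Z.of_nat m + 2)) = - (Z.of_nat m + 2) by apply: act_wm_fixed; lia.
have W_1 : Z.abs (W 1) = 1 by have := W_spec 1; zlia.
have W_N1 : Z.abs (W (- (1))) = 1 by have := W_spec (- (1)); zlia.
have W'_1 : Z.abs (W' 1) = 1 by have := W'_spec 1; zlia.
have W'_N1 : Z.abs (W' (- (1))) = 1 by have := W'_spec (- (1)); zlia.
have W'_t : W' (Z.of_nat m + 2) = - 2 by have := W'_spec (Z.of_nat m + 2); zlia.
have W'_Nt : W' (- (Z.of_nat m + 2)) = 2 by have := W'_spec (- (Z.of_nat m + 2)); zlia.
have inS p : p \in S -> p \notin inversions (wm n m) /\ p \in inversions (wm n m.+2).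
  rewrite /S !(in_setU, in_set1) -!orbA; case: p => x y; rewrite !xpair_eqE.
  move=> /or4P[]/andP[/eqP-> /eqP->]; (split;
    [apply/negP; case/inversionsP | apply/inversionsP; split]);
      rewrite ?coord_opp ca ct -/W -/W'; lia.
have disj : S :&: inversions (wm n m) = set0.
  by apply/setP => p; rewrite inE in_set0; apply/andP => -[/inS[/negP]].
rewrite addnC -cardS -cardsUI disj cards0 addn0; apply: subset_leq_card.
apply/subsetP => p; rewrite inE => /orP[/inS[] // |].
case: p => x y /inversionsP[lt_xy neq_xy W_gt]; apply/inversionsP; split=> //.
move: (coord_dom x) (coord_dom y) lt_xy neq_xy W_gt; rewrite -/W -/W'.
move: (coord x) (coord y) => {}x {}y x_dom y_dom lt_xy neq_xy W_gt.
(* Apart from 1, [m + 2] and their negatives, the only change is at the even positions up to [m] in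
   absolute value, where the image moves 2 farther from 0. *)
have cmp z : dom z -> W' z = W z /\ W z = z /\ 3 <= Z.abs z
    \/ Z.abs z = 1 /\ Z.abs (W z) = 1 /\ Z.abs (W' z) = 1
    \/ Z.abs z = Z.of_nat m + 2 /\ W z = z /\ (0 < z /\ W' z = - 2 \/ z < 0 /\ W' z = 2)
    \/ 2 <= z <= Z.of_nat m /\ W z = - (Z.of_nat m + 2 - z) /\ W' z = W z - 2
    \/ 2 <= - z <= Z.of_nat m /\ W z = Z.of_nat m + 2 + z /\ W' z = W z + 2.
  have M_even : Z.of_nat m mod 2 = 0 by zlia.
  move=> z_dom; move: (W_spec z z_dom) (W'_spec z z_dom) (z_dom) M_even (Zle_0_nat m).
  rewrite !Nat2Z.inj_succ; move: (Z.of_nat m) (W z) (W' z) => M c c';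
    clear=> Wz W'z z_d M_even M_ge0.
  have [z1 | z_neq1] := Z.eq_dec (Z.abs z) 1; first by right; left; lia.
  have [zM | z_neqM] := Z.eq_dec (Z.abs z) (M + 2).
    have cz : c = z by lia.
    have z_even : z mod 2 = 0 by zlia.
    by right; right; left; lia.
  case: Wz => [[-> Wz] | [|[[z_le [z_even ->]]|[z_le [z_even ->]]]]]; first by left; zlia.
  - by lia.
  - by right; right; right; left; lia.
  by right; right; right; right; lia.
move: (cmp x x_dom) (cmp y y_dom) W_gt.
move: (W x) (W y) (W' x) (W' y) lt_xy neq_xy => a1 a2 b1 b2; clear => lt_xy neq_xy.
by case=> [|[|[|[]]]] ?; case=> [|[|[|[]]]] ? ?; lia.
Qed.

End Wm.
(** * Supports *)

Section Support.

Variable n : nat.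
Hypothesis n_gt1 : (1 < n)%N.
Implicit Types (w v : {perm point n}) (i j : 'I_n) (e : seq 'I_n) (m : nat).
Local Notation inv2 w := #|inversions w|.
Local Notation dom z := (1 <= Z.abs z <= Z.of_nat n).

(* Left multiplication along a reduced expression only adds inversions. *)
Lemma reduced_cons j e : (size (j :: e)).*2 = inv2 (word (j :: e)) ->
  (size e).*2 = inv2 (word e) /\ ascent (word e) j.
Proof.
move=> size_e; have vs := word_signed n_gt1 e.
have le_e := inv2_word_le n_gt1 e.
have [asc | desc] := Z_lt_dec (act (word e)^-1%g (lo j)) (act (word e)^-1%g (hi j)).
  split=> //; have /= := inv2_ascent n_gt1 vs asc;
    rewrite -[word (j :: e)]/(perm_comp _ _) in size_e.
  by rewrite -size_e /= doubleS => -[].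
have := inv2_descent n_gt1 vs desc;
  rewrite -[perm_comp _ _]/(word (j :: e)) -size_e => inv_e.
by move: le_e; rewrite inv_e /= doubleS; lia.
Qed.

(** Generators other than [gen i] preserve the points of absolute value at most [i] and the points
    above [i]; [2 <= i] keeps index 0 inside this border. The first [gen i] met from the right
    inverts a pair across the border, and a reduced expression never undoes an inversion. *)
Lemma reduced_crossing e i : (2 <= i)%N -> (size e).*2 = inv2 (word e) ->
  if i \in e then exists x y, [/\ dom x, dom y, Z.abs x <= Z.of_nat i,
      Z.of_nat i < y & act (word e) y < act (word e) x]
  else forall z, dom z -> (Z.abs z <= Z.of_nat i -> Z.abs (act (word e) z) <= Z.of_nat i)
      /\ (Z.of_nat i < z -> Z.of_nat i < act (word e) z).
Proof.
move=> i_ge2; have lo_i : lo i = Z.of_nat i by rewrite loE //; lia.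
have hi_i : hi i = Z.of_nat i + 1 by rewrite hiE //; lia.
elim: e => [_ z z_dom|j e IHe]; first by rewrite /= act1.
move=> /reduced_cons[/IHe {}IHe asc]; have vs := word_signed n_gt1 e.
rewrite inE; case: (boolP (i \in e)) IHe => [i_e [x [y [x_d y_d x_le y_gt
  lt_yx]]]|i_e stab].
  rewrite orbT; exists x, y; split=> //; rewrite /= !actM // !act_gen //;
    try exact: act_dom.
  have Wx_d := act_dom (word e) x_d; have Wy_d := act_dom (word e) y_d.
  have neq : act (word e) y <> - act (word e) x.
    by rewrite -act_opp //; apply: act_neq => //; lia.
  apply: refl_lt => //; try lia.
    have [eq_y | ] := Z.eq_dec (act (word e) y) (lo j); last by lia.
    have [eq_x | ] := Z.eq_dec (act (word e) x) (hi j); last by lia.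
    by move: asc; rewrite /ascent -eq_x -eq_y !actK //; lia.
  have [eq_y | ] := Z.eq_dec (act (word e) y) (- hi j); last by lia.
  have [eq_x | ] := Z.eq_dec (act (word e) x) (- lo j); last by lia.
  move: asc; rewrite /ascent (_ : lo j = - act (word e) x); last by lia.
  rewrite (_ : hi j = - act (word e) y); last by lia.
  by rewrite !(act_opp (signedV vs)) // !actK //; lia.
rewrite orbF; case: eqP => [eq_ij | neq_ij].
  rewrite -eq_ij /= in asc *; have lo_d := lo_dom i n_gt1; have hi_d := hi_dom i n_gt1.
  have x_d := act_dom (word e)^-1%g lo_d; have y_d := act_dom (word e)^-1%g hi_d.
  have Wx := actVK (word e) lo_d; have Wy := actVK (word e) hi_d.
  have [x_st x_gt] := stab _ x_d; have [y_st y_gt] := stab _ y_d.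
  have [|_ Nx_gt] := stab (- act (word e)^-1%g (lo i)); first lia.
  have [|_ Ny_gt] := stab (- act (word e)^-1%g (hi i)); first lia.
  rewrite !act_opp // in Nx_gt Ny_gt.
  exists (act (word e)^-1%g (lo i)), (act (word e)^-1%g (hi i)); split=> //; try lia.
  by rewrite !actM // !act_gen ?Wx ?Wy // -!(act_gen n_gt1) // act_gen_lo //
    act_gen_hi // ; lia.
move=> z z_d; have := stab z z_d; have Wz_d := act_dom (word e) z_d.
rewrite /= actM // act_gen //; move: (act (word e) z) Wz_d => c c_d.
have neq_ij' : nat_of_ord j <> nat_of_ord i by move=> /ord_inj/esym.
have [j0 | j_neq0] := eqVneq (nat_of_ord j) 0%N.
  by rewrite j0 /lo /hi; refl_cases.
by rewrite loE ?hiE ?lt0n //; refl_cases.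
Qed.

(** Fixing all points beyond [m], [wm n m] carries no point across the border at [i], so the pair
    from [reduced_crossing] cannot exist. *)
Lemma supp_wm m i : (m <= n)%N -> ~~ odd m -> (m < i)%N -> ~ supp (wm n m) i.
Proof.
move=> le_mn m_even lt_mi [e red_e i_e]; have wD := wm_WD le_mn m_even.
have [def_e size_e] := (reduced_exprP n_gt1 _ wD).1 red_e.
(* For [m = 0] the index [i] may be 1, outside the range of [reduced_crossing]; but the reduced
   expression of the identity is empty. *)
have [m0 | m_neq0] := eqVneq m 0%N.
  by move: size_e; rewrite m0 wm0 inv2_1; case: (e) i_e.
rewrite -def_e in size_e; have i_ge2 : (2 <= i)%N by lia.
have := reduced_crossing i_ge2 size_e; rewrite i_e => -[x [y [x_d y_d x_le y_gt]]].
rewrite def_e (act_wm_fixed n_gt1 le_mn m_even y_d); last by lia.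
have Wx_d := act_dom (wm n m) x_d; have := act_wmK m x_d.
have := act_wm_fixed n_gt1 le_mn m_even Wx_d; lia.
Qed.

End Support.

(** * Classification of the bad elements *)

Section Classification.

Variable n : nat.
Hypothesis n_gt1 : (1 < n)%N.
Implicit Types (w v u : {perm point n}) (i j : 'I_n) (e : seq 'I_n) (m : nat).
Local Notation inv2 w := #|inversions w|.
Local Notation dom z := (1 <= Z.abs z <= Z.of_nat n).

(** What remains of a bad element, and of its inverse, once the part on [[-m, m]] is split off. *)
Record tail m (f : Z -> Z) : Prop := Tail {
  tail_id : forall z, 1 <= z -> z <= Z.of_nat m -> f z = z;
  tail_gt0 : forall z, Z.of_nat m < z -> z <= Z.of_nat n -> 0 < f z;
  tail_incr : forall a b, Z.of_nat m + 1 <= a -> b = a + 2 -> b <= Z.of_nat n ->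
    f a < f b }.

Lemma tail_gt m u z : (m <= n)%N -> signed u -> tail m (act u) ->
  Z.of_nat m < z -> z <= Z.of_nat n -> Z.of_nat m < act u z <= Z.of_nat n.
Proof.
move=> le_mn us uT z_gt z_le; have z_d : dom z by lia.
have := tail_gt0 uT z_gt z_le; have := act_dom u z_d.
have [//|le_m] := Z_lt_le_dec (Z.of_nat m) (act u z); first by lia.
move=> uz_d uz_gt; have := tail_id uT (z := act u z).
have := act_neq (w := u) uz_d z_d; lia.
Qed.

(** The inverse takes [m + 1], its least value beyond [m], at [act u (m + 1)]. Since it increases
    along each parity class, this is the first position of a class. *)
Lemma tail_first m u : (m < n)%N -> signed u ->
    tail m (act u) -> tail m (act u^-1%g) ->
  act u (Z.of_nat m + 1) = Z.of_nat m + 1 \/ act u (Z.of_nat m + 1) = Z.of_nat m + 2.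
Proof.
move=> lt_mn us uT vT; have vs := signedV us.
have c_d : dom (Z.of_nat m + 1) by lia.
have c_gt := tail_gt (ltnW lt_mn) us uT (z := Z.of_nat m + 1).
have Vc := actK u c_d; set c := act u _ in c_gt Vc *.
have V_lt := lt_step2 (tail_incr vT).
have V_gt := tail_gt (ltnW lt_mn) vs vT.
have [par | par] := Z.eq_dec (c mod 2) ((Z.of_nat m + 1) mod 2).
  have := V_lt (Z.of_nat m + 1) c; have := V_gt (Z.of_nat m + 1); lia.
have := V_lt (Z.of_nat m + 2) c; have := V_gt (Z.of_nat m + 2); zlia.
Qed.

(** Either [m + 1] is fixed, or it is exchanged with [m + 2] and a generator splits off. Each
    generator uses up two positions, whence the bound on [size e]. *)
Lemma tail_word m u : (m <= n)%N -> signed u ->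
    tail m (act u) -> tail m (act u^-1%g) ->
  exists e, [/\ u = word e, {in e, forall i, (m < i)%N},
    {in e &, forall i j, commute (gen i) (gen j)} & (2 * size e + m <= n)%N].
Proof.
have [k] := ubnP (n - m); elim: k m u => // k IHk m u le_k le_mn us uT vT.
have vs := signedV us.
have [eq_mn | neq_mn] := eqVneq m n.
  exists [::]; split=> //.
  apply: act_inj => // [|z z_gt]; first exact: signed1.
  by rewrite act1; [apply: (tail_id uT); lia | lia].
have lt_mn : (m < n)%N by lia.
have c_d : dom (Z.of_nat m + 1) by lia.
have [u_fix | u_swap] := tail_first lt_mn us uT vT.
  have v_fix : act u^-1%g (Z.of_nat m + 1) = Z.of_nat m + 1.
    by rewrite -{1}u_fix actK.
  have [|||||e [-> e_gt comm size_e]] := IHk m.+1 u; [lia | lia | by [] | | |].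
  - split=> [z z_ge z_le | z z_gt z_le | i j i_ge def_j j_le].
    + have [-> | z_neq] := Z.eq_dec z (Z.of_nat m + 1); first by [].
      by apply: (tail_id uT); lia.
    + by apply: (tail_gt0 uT); lia.
    by apply: (tail_incr uT); lia.
  - split=> [z z_ge z_le | z z_gt z_le | i j i_ge def_j j_le].
    + have [-> | z_neq] := Z.eq_dec z (Z.of_nat m + 1); first by [].
      by apply: (tail_id vT); lia.
    + by apply: (tail_gt0 vT); lia.
    by apply: (tail_incr vT); lia.
  by exists e; split=> //; [move=> i /e_gt; lia | lia].
have v_swap : act u^-1%g (Z.of_nat m + 1) = Z.of_nat m + 2.
  have uT' : tail m (act u^-1^-1%g) by rewrite invgK.
  have [v_fix|//] := tail_first lt_mn vs vT uT'.
  by have := actVK u c_d; rewrite v_fix u_swap; lia.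
have c2_d : dom (Z.of_nat m + 2) by rewrite -u_swap; apply: act_dom.
have u_swap2 : act u (Z.of_nat m + 2) = Z.of_nat m + 1 by rewrite -v_swap actVK.
have v_swap2 : act u^-1%g (Z.of_nat m + 2) = Z.of_nat m + 1 by rewrite -u_swap actK.
have lt_m1n : (m.+1 < n)%N by lia.
pose i0 := Ordinal lt_m1n; pose u' := perm_comp (gen i0) u.
have lo_i0 : lo i0 = Z.of_nat m + 1 by rewrite loE /=; lia.
have hi_i0 : hi i0 = Z.of_nat m + 2 by rewrite hiE /=; lia.
have gen_id z : dom z -> z <> Z.of_nat m + 1 -> z <> Z.of_nat m + 2 -> 0 < z ->
    act (gen i0) z = z.
  by move=> *; rewrite act_gen // lo_i0 hi_i0; refl_cases.
have gen1 : act (gen i0) (Z.of_nat m + 1) = Z.of_nat m + 2.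
  by rewrite -lo_i0 act_gen_lo // hi_i0.
have gen2 : act (gen i0) (Z.of_nat m + 2) = Z.of_nat m + 1.
  by rewrite -hi_i0 act_gen_hi // lo_i0.
have u'_gt z : Z.of_nat m + 2 < z -> z <= Z.of_nat n -> act u' z = act u z.
  move=> z_gt z_le; have z_d : dom z by lia.
  rewrite actM //; apply: gen_id; first exact: act_dom.
  - by rewrite -u_swap2; apply: act_neq => //; lia.
  - by rewrite -u_swap; apply: act_neq => //; lia.
  by apply: (tail_gt0 uT); lia.
have v'_gt z : Z.of_nat m + 2 < z -> z <= Z.of_nat n -> act u'^-1%g z = act u^-1%g z.
  by move=> z_gt z_le; rewrite actV_gen ?gen_id //; lia.
have u'_id z : 1 <= z -> z <= Z.of_nat m + 2 -> act u' z = z.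
  move=> z_ge z_le; have z_d : dom z by lia.
  rewrite actM //; have [-> | z_neq1] := Z.eq_dec z (Z.of_nat m + 1).
    by rewrite u_swap gen2.
  have [-> | z_neq2] := Z.eq_dec z (Z.of_nat m + 2); first by rewrite u_swap2 gen1.
  by rewrite (tail_id uT) ?gen_id; lia.
have v'_id z : 1 <= z -> z <= Z.of_nat m + 2 -> act u'^-1%g z = z.
  by move=> z_ge z_le; rewrite -{1}(u'_id z) // actK; lia.
have u's : signed u' by apply: signedM => //; apply: gen_signed.
have [|||||e [def_u' e_gt comm size_e]] := IHk m.+2 u' => //; [lia | | |].
- split=> [z z_ge z_le | z z_gt z_le | i j i_ge def_j j_le].
  + by apply: u'_id; lia.
  + by rewrite u'_gt; [apply: (tail_gt0 uT); lia | lia | lia].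
  by rewrite !u'_gt; [apply: (tail_incr uT); lia | lia..].
- split=> [z z_ge z_le | z z_gt z_le | i j i_ge def_j j_le].
  + by apply: v'_id; lia.
  + by rewrite v'_gt; [apply: (tail_gt0 vT); lia | lia | lia].
  by rewrite !v'_gt; [apply: (tail_incr vT); lia | lia..].
have comm0 i : i \in e -> commute (gen i0) (gen i).
  move=> /e_gt lt_mi; apply: commute_gen => //; rewrite ?lo_i0 ?hi_i0 ?loE ?hiE; lia.
exists (i0 :: e); split.
- by rewrite /= -def_u' gen_mulK.
- by move=> i; rewrite inE => /predU1P[-> // | /e_gt]; lia.
- move=> i j; rewrite !inE => /predU1P[-> | i_e] /predU1P[-> | j_e] //.
  + exact: comm0.
  + exact/commute_sym/comm0.
  exact: comm.
by rewrite /=; lia.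
Qed.

(* [c] is the part of [w] acting on [-m, m]. *)
Lemma tame_factor m c w : (m <= n)%N -> signed c -> signed w ->
    tame (Z.of_nat n) (act w) (act w^-1%g) ->
    tame (Z.of_nat n) (act w^-1%g) (act w) ->
    perm_comp c c = 1%g ->
    (forall z, dom z -> Z.of_nat m < Z.abs z -> act c z = z) ->
    (forall z, 1 <= z -> z <= Z.of_nat m -> act w z = act c z) ->
    (forall z, Z.of_nat m < z -> z <= Z.of_nat n -> 0 < act w z) ->
  exists e, [/\ w = perm_comp c (word e), {in e, forall i, (m < i)%N},
    {in e &, forall i j, commute (gen i) (gen j)} & (2 * size e + m <= n)%N].
Proof.
move=> le_mn cs ws WP VP cc c_id w_le w_gt; have vs := signedV ws.
have cK z : dom z -> act c (act c z) = z by move=> z_d; rewrite -actM // cc act1.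
have c_le z : dom z -> Z.abs z <= Z.of_nat m -> Z.abs (act c z) <= Z.of_nat m.
  move=> z_d z_le; have cz_d := act_dom c z_d.
  by have := c_id _ cz_d; have := cK z z_d; lia.
have w_le' z : dom z -> Z.abs z <= Z.of_nat m -> act w z = act c z.
  move=> z_d z_le; have [z_gt0 | z_le0] := Z_lt_le_dec 0 z; first by apply: w_le; lia.
  rewrite -[z]Z.opp_involutive !(act_opp (z := - z)) //; try lia.
  by rewrite w_le //; lia.
have w_gt' z : Z.of_nat m < z -> z <= Z.of_nat n -> Z.of_nat m < act w z.
  move=> z_gt z_le; have z_d : dom z by lia.
  have wz_d := act_dom w z_d; have := w_gt z z_gt z_le.
  have [//|wz_le wz_gt] := Z_lt_le_dec (Z.of_nat m) (act w z).
  (* A value within [[-m, m]] is already taken at its image under [c], which again lies in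
     [[-m, m]]. *)
  have y_d := act_dom c wz_d; have y_le := c_le _ wz_d.
  have := w_le' _ y_d; rewrite cK //.
  have := act_neq (w := w) y_d z_d; lia.
have v_gt z : Z.of_nat m < z -> z <= Z.of_nat n -> 0 < act w^-1%g z.
  move=> z_gt z_le; have z_d : dom z by lia.
  have y_d := act_dom w^-1%g z_d; have wy := actVK w z_d.
  have [//|y_le] := Z_lt_le_dec 0 (act w^-1%g z).
  have := act_opp ws y_d; rewrite wy; have := w_gt (- act w^-1%g z).
  have := w_le' (act w^-1%g z) y_d; rewrite wy.
  have := c_le (act w^-1%g z) y_d; lia.
pose u := perm_comp c w; have us : signed u by apply: signedM.
have def_w : w = perm_comp c u by rewrite /u perm_compA cc /perm_comp mulg1.
have u_le z : 1 <= z -> z <= Z.of_nat m -> act u z = z.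
  by move=> z_ge z_le; rewrite actM ?w_le ?cK //; lia.
have u_gt z : Z.of_nat m < z -> z <= Z.of_nat n -> act u z = act w z.
  move=> z_gt z_le; have z_d : dom z by lia.
  by rewrite actM // c_id; [| apply: act_dom | have := w_gt' z; lia].
have cV : c^-1%g = c by apply/eqP; rewrite eq_invg_mul -[(_ * _)%g]/(perm_comp c c) cc.
have uV : u^-1%g = perm_comp w^-1%g c by rewrite /u /perm_comp invMg cV.
have v_le z : 1 <= z -> z <= Z.of_nat m -> act u^-1%g z = z.
  by move=> z_ge z_le; rewrite -{1}(u_le z) // actK; lia.
have v_gt' z : Z.of_nat m < z -> z <= Z.of_nat n -> act u^-1%g z = act w^-1%g z.
  by move=> z_gt z_le; rewrite uV actM ?c_id; lia.
have [||e [def_u e_gt comm size_e]] := tail_word le_mn us.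
- split=> [// | z z_gt z_le | i j i_ge def_j j_le].
    by rewrite u_gt //; apply: w_gt.
  by rewrite !u_gt; [apply: (tame_incr WP); lia | lia..].
- split=> [// | z z_gt z_le | i j i_ge def_j j_le].
    by rewrite v_gt' //; apply: v_gt.
  by rewrite !v_gt'; [apply: (tame_incr VP); lia | lia..].
by exists e; rewrite -def_u.
Qed.

(** The bound on [size e] limits the contribution of the commuting factor when lengths are
    compared. *)
Lemma bad_shape w : bad w -> exists m e, [/\ ~~ odd m, (m <= n)%N,
  w = perm_comp (wm n m) (word e), {in e, forall i, ~ supp (wm n m) i} &
  {in e &, forall i j, commute (gen i) (gen j)} /\ (2 * size e + m <= n)%N].
Proof.
case/(badP n_gt1) => wD _ incr_w incr_v; have ws := WD_signed wD.
have WP := incr3_tame n_gt1 ws incr_w.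
have VP := incr3_tame n_gt1 (signedV ws) incr_v; rewrite invgK in VP.
pose i0 : 'I_n := Ordinal (ltnW n_gt1); pose i1 : 'I_n := Ordinal n_gt1.
have d1 : dom 1 by lia.
have d2 : dom 2 by lia.
have W1_d := act_dom w d1; have W2_d := act_dom w d2.
have sgn1 (v : {perm point n}) : (v (pos i0)).1 = (act v 1 <? 0) by rewrite -act_lt0.
have sgn2 (v : {perm point n}) : (v (pos i1)).1 = (act v 2 <? 0) by rewrite -act_lt0.
have [W1 | W1_neq1] := Z.eq_dec (Z.abs (act w 1)) 1.
  have [|M [M_even M_le W_le W_gt]] := tame_shape WP VP _ W1; first by lia.
  pose m := Z.to_nat M; have m_even : ~~ odd m by zlia.
  have le_mn : (m <= n)%N by lia.
  have cD := wm_WD le_mn m_even; have c_spec z := act_wm_spec n_gt1 (z := z) le_mn m_even.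
  have def_M : M = Z.of_nat m by lia.
  have c1 : Z.abs (act (wm n m) 1) = 1 by have := c_spec 1; zlia.
  have W_c z : 2 <= z -> z <= M -> act w z = act (wm n m) z.
    move=> z_ge z_le; rewrite W_le //; have := c_spec z.
    by case: Z.eqb_spec; zlia.
  have W_sgn z : 2 <= z -> z <= Z.of_nat n -> (act w z <? 0) = (act (wm n m) z <? 0).
    move=> z_ge z_le; have [lt_Mz | le_zM] := Z_lt_le_dec M z.
      by have := W_gt z; have := c_spec z; do 2!case: Z.ltb_spec; lia.
    by rewrite W_c.
  have W1c : act w 1 = act (wm n m) 1.
    have := @WD_sign _ w (wm n m) i0 wD cD; rewrite !sgn1 => sgn_eq.
    have {sgn_eq} : (act w 1 <? 0) = (act (wm n m) 1 <? 0).
      apply: sgn_eq => i; rewrite -val_eqE -!act_lt0 /= => i_neq0.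
      by apply: W_sgn; have := ltn_ord i; lia.
    by do 2!case: Z.ltb_spec => ? //; lia.
  have [||||e [-> e_gt comm size_e]] := @tame_factor m (wm n m) w le_mn
    (@wm_signed n m) ws WP VP.
  - by rewrite /perm_comp -{1}wmV mulVg.
  - by move=> z z_d z_gt; apply: act_wm_fixed.
  - move=> z z_ge z_le; have [-> // | z_neq1] := Z.eq_dec z 1.
    by apply: W_c; lia.
  - move=> z z_gt z_le; have [z1 | z_neq1] := Z.eq_dec z 1; last by apply: W_gt; lia.
    by rewrite z1 W1c; have := act_wm_fixed n_gt1 le_mn m_even d1; lia.
  by exists m, e; split=> // i /e_gt; apply: supp_wm.
(* Here 1 and 2 are exchanged up to sign and all later values are positive, so by parity both signs
   change or neither does. In the first case [gen i0] is split off; in the second the whole of [w]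
   is a tail. *)
have [|W1 V1] := tame1_neq1 WP VP _ W1_neq1; first by lia.
have W2 : Z.abs (act w 2) = 1.
  have := tame_eq VP (i := 1) (j := 2); have := tame_eqN VP WP (i := 1) (j := 2).
  by lia.
have W_gt z : 3 <= z -> z <= Z.of_nat n -> 0 < act w z.
  move=> z_ge z_le; have [z_even | z_odd] := mod2_cases z.
    have := tame_lt WP (i := 2) (j := z); have := act_dom w (z := z); zlia.
  by have := tame_odd_lt WP (i := 1) (j := z); zlia.
have W_sgn (i : 'I_n) : (2 <= i)%N -> (w (pos i)).1 = false.
  move=> i_ge; rewrite -act_lt0; apply/Z.ltb_ge.
  by have := W_gt (Z.of_nat i.+1); have := ltn_ord i; lia.
have sgnI (i : 'I_n) : i != i0 -> i != i1 -> (w (pos i)).1 = false.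
  by rewrite -!val_eqE /= => *; apply: W_sgn; lia.
have no_supp0 (i : 'I_n) : (0 < i)%N -> ~ supp (wm n 0) i by apply: supp_wm.
have par1 : (w (pos i1)).1 = false -> (w (pos i0)).1 = false.
  move=> w1; rewrite (WD_sign wD (@WD1 n)) ?perm1 // => i i_neq0; rewrite perm1.
  by have [-> // | i_neq1] := eqVneq i i1; apply: sgnI.
have par2 : (w (pos i0)).1 = false -> (w (pos i1)).1 = false.
  move=> w0; rewrite (WD_sign wD (@WD1 n)) ?perm1 // => i i_neq1; rewrite perm1.
  by have [-> // | i_neq0] := eqVneq i i0; apply: sgnI.
rewrite sgn1 sgn2 in par1 par2.
have [W1_gt0 | W1_lt0] := Z_lt_le_dec 0 (act w 1).
  have W2_gt0 : 0 < act w 2.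
    have /Z.ltb_ge : (act w 2 <? 0) = false by apply/par2/Z.ltb_ge; lia.
    by lia.
  have [||||e [-> e_gt comm size_e]] :=
      @tame_factor 0 1%g w (leq0n n) (@signed1 n) ws WP VP.
  - by rewrite /perm_comp mulg1.
  - by move=> z z_d _; rewrite act1.
  - by move=> z *; lia.
  - move=> z z_gt z_le; have [-> // | z_neq1] := Z.eq_dec z 1.
    have [-> // | z_neq2] := Z.eq_dec z 2; apply: W_gt; lia.
  by exists 0%N, e; rewrite wm0; split=> // i /e_gt; rewrite -wm0; apply: no_supp0.
have W1_eq : act w 1 = - 2 by lia.
have W2_eq : act w 2 = - 1.
  have [W2_gt0 | W2_lt0] := Z_lt_le_dec 0 (act w 2); last by lia.
  have /Z.ltb_ge : (act w 1 <? 0) = false by apply/par1/Z.ltb_ge; lia.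
  by lia.
have [||||e [def_w e_gt comm size_e]] :=
    @tame_factor 2 (gen i0) w n_gt1 (gen_signed i0 n_gt1) ws WP VP.
- by apply/permP => x; rewrite permM genK // perm1.
- by move=> z z_d z_gt; rewrite act_gen // /lo /hi /=; refl_cases.
- move=> z z_ge z_le; have [-> | z_neq1] := Z.eq_dec z 1.
    by rewrite W1_eq act_gen.
  by rewrite (_ : z = 2) ?W2_eq ?act_gen //; lia.
- by move=> z *; apply: W_gt; lia.
exists 0%N, (i0 :: e); split=> //.
- by rewrite wm0 /perm_comp mulg1; apply: def_w.
- by move=> i _ [f /(reduced_exprP n_gt1 _ (wm_WD (leq0n n) isT))[_]];
    rewrite wm0 inv2_1; case: f.
split; last by rewrite /=; lia.
have comm0 i : i \in e -> commute (gen i0) (gen i).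
  by move=> /e_gt lt_2i; apply: commute_gen => //=;
    rewrite ?(loE (k := i)) ?(hiE (k := i)); lia.
move=> i j; rewrite !inE => /predU1P[-> | i_e] /predU1P[-> | j_e] //.
- exact: comm0.
- exact/commute_sym/comm0.
exact: comm.
Qed.

End Classification.

(* The longest bad element *)
Local Close Scope Z_scope.

Theorem theorem2p36 (n : nat) (hn : 4 <= n) :
  [/\ unique (@longest_bad n) (wm n n),
      forall w : {perm point n}, bad w -> w <> wm n n ->
        exists (k : nat) (u : {perm point n}),
          [/\ k < n,
              commuting_product (fun i => ~ supp (wm n k) i) u
            & w = perm_comp (wm n k) u]
    & odd n -> wm n n = wm n n.-1].
Proof.
have n_gt1 : (1 < n)%N by apply: leq_trans hn.
set m := (n - odd n)%N; have le_mn : (m <= n)%N by apply: leq_subr.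
have m_even : ~~ odd m := even_part n.
have def_wn : wm n n = wm n m := wm_even_part n n.
have m_ge4 : (4 <= m)%N by rewrite /m; lia.
have m_max k : ~~ odd k -> (k <= n)%N -> (k <= m)%N by rewrite /m; lia.
have shape w : bad w -> w <> wm n n -> exists k e, [/\ (k < n)%N, (k < m)%N,
    ~~ odd k, w = perm_comp (wm n k) (word e)
  & [/\ {in e, forall i, ~ supp (wm n k) i},
        {in e &, forall i j, commute (gen i) (gen j)} & (2 * size e + k <= n)%N]].
  case/(bad_shape n_gt1) => k [e [k_even le_kn def_w e_supp [comm size_e]]] neq_w.
  have [lt_km | ge_km] := ltnP k m; first by exists k, e; split=> //; lia.
  (* For [k = m] at most one position is left over, and the bound on [size e] makes [e] empty. *)
  case: neq_w; have eq_km : k = m by have := m_max k; lia.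
  have e_nil : e = [::] by apply: size0nil; move: size_e; rewrite eq_km /m; lia.
  by rewrite def_w e_nil eq_km def_wn /perm_comp mul1g.
have wnD : wm n m \in WD n by apply: wm_WD.
have lengthW k : ~~ odd k -> (k <= m)%N ->
    (#|inversions (wm n k)| + 2 * (m - k) <= #|inversions (wm n m)|)%N.
  have [d] := ubnP (m - k); elim: d k => // d IHd k lt_d k_even le_km.
  have [-> | neq_km] := eqVneq k m; first by rewrite subnn addn0.
  have k2_even : ~~ odd k.+2 by rewrite /= negbK.
  have lt_k1m : (k.+2 <= m)%N by move: (odd m) (odd k) m_even k_even; lia.
  have := IHd k.+2; have := inv2_wm_step n_gt1 k_even (leq_trans lt_k1m le_mn).
  move: #|_| #|_| #|_| => a b c; lia.
(* The commuting factor adds at most [n - k <= m - k + 1] counted inversions, fewer than the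
   [2 * (m - k)] gained from [k] to [m], because [m - k >= 2]. *)
have shorter w : bad w -> w <> wm n n ->
    (#|inversions w| < #|inversions (wm n m)|)%N.
  move=> wB neq_w; have [k [e [lt_kn lt_km k_even -> [_ _ size_e]]]] := shape w wB neq_w.
  have le_kn := ltnW lt_kn.
  have [f [def_f size_f]] := exists_word n_gt1 (wm_WD le_kn k_even).
  have := inv2_word_le n_gt1 (f ++ e); rewrite word_cat def_f size_cat doubleD size_f.
  have := lengthW k k_even (ltnW lt_km); move: size_e; rewrite /m.
  move: #|_| #|_| #|_| => a b c; lia.
have wn_bad : bad (wm n n).
  rewrite def_wn; apply/(badP n_gt1); rewrite wmV.
  have spec z := act_wm_spec n_gt1 (z := z) le_mn m_even.
  have incr : incr3 (wm n m).
    move=> i j eq_ij; have := spec _ (lo_dom i n_gt1); have := spec _ (hi_dom j n_gt1).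
    have := hi_dom j n_gt1; move: eq_ij; clear -m_ge4.
    move: (act _ (lo i)) (act _ (hi j)) => a b.
    case: (val i) (val j) => [|k] [|l] /= eq_ij hi_d spec_hi spec_lo; zlia.
  split=> // -[e [_ comm def_w]].
  (* The point 2 goes to [- m], and [m >= 4] is more than one away in absolute value. *)
  have := commuting_word_near n_gt1 (z := 2%Z) comm; rewrite -def_w.
  by have := spec 2%Z; zlia.
have [e0 [def_e0 size_e0]] := exists_word n_gt1 wnD.
have wn_length : has_length (wm n n) (size e0).
  by rewrite def_wn; apply/(has_lengthP n_gt1 _ wnD).
split.
- split=> [|w [wB [l len_w max_w]]].
    split=> //; exists (size e0) => // v k vB.
    have vD : v \in WD n by case: vB.
    move/(has_lengthP n_gt1 _ vD) => len_v.
    rewrite -leq_double len_v size_e0 -def_wn.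
    by have [-> // | /eqP neq_v] := eqVneq v (wm n n); rewrite def_wn ltnW // shorter.
  have [//|/eqP neq_w] := eqVneq w (wm n n).
  have wD : w \in WD n by case: wB.
  have := shorter w wB neq_w; rewrite -size_e0 ltnNge.
  by move/(has_lengthP n_gt1 _ wD): len_w => <-; rewrite leq_double (max_w _ _ wn_bad).
- move=> w wB neq_w; have [k [e [lt_kn _ _ def_w [e_supp comm _]]]] := shape w wB neq_w.
  by exists k, (word e); split=> //; exists e.
move=> n_odd; rewrite (wm_even_part n n) (wm_even_part n n.-1); congr (wm n _).
by case: (n) n_odd => //= k; case: (odd k); rewrite ?subn1 ?subn0.
Qed.
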